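(* If $n\geqslant 17$ is an odd integer, then $$\sigma(n)<\frac{2}{3}\,e^{\gamma}\,n\log\log(2n).$$
   Context: $\sigma(n)=\sum_{d\mid n} d$; $\gamma$ is Euler's constant. *)

(* Defs.v *)
From mathcomp Require Import all_boot all_order all_algebra.
From mathcomp Require Import all_classical all_reals all_analysis.
Set Implicit Arguments.
Unset Strict Implicit.
Unset Printing Implicit Defensive.
Import Order.TTheory GRing.Theory Num.Theory.
Import numFieldNormedType.Exports.
Local Open Scope classical_set_scope.
Local Open Scope ring_scope.

(* [divisors n] is the list of divisors of [n] only when [0 < n]. *)
Definition sigma (n : nat) : nat := (\sum_(d <- divisors n) d)%N.

Definition euler_seq (R : realType) (n : nat) : R :=
  \sum_(1 <= k < n.+1) k%:R^-1 - ln n%:R.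

Definition euler_gamma (R : realType) : R := limn (euler_seq R).

(* [limn] returns an arbitrary value on divergent sequences; this one does
   converge. *)
Lemma is_cvg_euler_seq (R : realType) : cvgn (euler_seq R).
Proof.
have step n : ln (n.+2%:R : R) <= ln n.+1%:R + n.+1%:R^-1.
  have -> : n.+2%:R = n.+1%:R * (1 + n.+1%:R^-1) :> R.
    by rewrite mulrDr mulr1 mulfV ?pnatr_eq0// natr1.
  have n0 : 0 < n.+1%:R^-1 :> R by rewrite invr_gt0 ltr0n.
  rewrite lnM ?posrE ?ltr0n// ?addr_gt0// lerD2l.
  by apply: le_ln1Dx; rewrite (lt_trans _ n0)// ltrN10.
have step' n : n.+2%:R^-1 <= ln (n.+2%:R : R) - ln n.+1%:R.
  have := @le_ln1Dx R (- n.+2%:R^-1).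
  have -> : 1 - n.+2%:R^-1 = n.+1%:R / n.+2%:R :> R.
    apply/eqP; rewrite subr_eq -[X in _ + X]mul1r -mulrDl natr1.
    by rewrite mulfV ?pnatr_eq0.
  rewrite ltrN2 invf_lt1 ?ltr0n// ltr1n => /(_ isT).
  by rewrite ln_div ?posrE ?ltr0n// lerNr opprB.
suff /cvg_ex[l] : cvgn [sequence euler_seq R n.+1]_n.
  by rewrite cvg_shiftS => ?; apply/cvg_ex; exists l.
apply: nonincreasing_is_cvgn.
  apply/nonincreasing_seqP => n; rewrite /euler_seq /= [in leLHS]big_nat_recr//=.
  by rewrite -addrA lerD2l lerBlDr [leRHS]addrC; exact: step'.
exists 0 => _ [n _ <-]; rewrite /euler_seq subr_ge0.
apply: (@le_trans _ _ (ln n.+2%:R)).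
  by rewrite ler_ln ?posrE ?ltr0n// ler_nat.
elim: n => [|n IH]; apply: le_trans (step _) _.
  by rewrite big_nat1 ln1 add0r.
by rewrite big_nat_recr//= lerD2r.
Qed.

(* Main.v *)
(* Since sigma(n) phi(n) <= n ^ 2, it suffices to bound N / phi(N), the product of
   p / (p - 1) over the primes p dividing N = 2n; write F(y) for the product over
   all primes p <= y.

   - N / phi(N) <= F(y) as soon as N is below y + 1 times the primorial of y, so
     finitely many values of y settle all N in [2 ^ 12, 2 ^ 5920); the odd n below
     2 ^ 11 are checked directly.
   - For larger N take y to be the integer part of ln N: the prime factors of N
     above y contribute at most exp((1 + 1 / y) / ln y), and F(y) is bounded by an
     explicit form of Mertens' theorems. Legendre's formula for y! together with
     the bound 4 ^ y on the primorial gives sum_(p <= y) ln p / p <= ln y + E, and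
     summation by parts from the starting point 4096, where F is computed, bounds
     F(y) / ln y. As 2/3 exceeds the optimal constant 1/2 by a third, crude error
     terms suffice. *)
Require Import Defs.
From Stdlib Require Import NArith.
From mathcomp Require Import all_boot all_order all_algebra.
From mathcomp Require Import all_classical all_reals all_analysis.
From mathcomp Require Import zify ring lra.
Import Order.TTheory GRing.Theory Num.Theory.
Local Open Scope ring_scope.

(** * Binary integers, in which the numerical checks are evaluated *)

Lemma N_leq (a b : N) : N.leb a b -> (N.to_nat a <= N.to_nat b)%N.
Proof. lia. Qed.

Lemma N_mul (a b : N) : N.to_nat (a * b)%num = (N.to_nat a * N.to_nat b)%N.
Proof. lia. Qed.

Lemma N_exp (a b : N) : N.to_nat (a ^ b)%num = (N.to_nat a ^ N.to_nat b)%N.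
Proof.
by rewrite N2Nat.inj_pow; elim: (N.to_nat b) => //= k ->; rewrite expnS.
Qed.

Lemma N_log2 (a : N) :
  (0 < N.to_nat a)%N -> (2 ^ N.to_nat (N.log2 a) <= N.to_nat a)%N.
Proof.
move=> a0; have [|h _] := N.log2_spec a; first lia.
by have -> : 2%N = N.to_nat 2 by []; rewrite -N_exp; lia.
Qed.

Lemma N_divM (a b : N) : (N.to_nat (a / b)%num * N.to_nat b <= N.to_nat a)%N.
Proof.
case: (N.eq_dec b 0) => [->|b0]; first lia.
have := N.Div0.mul_div_le a b; nia.
Qed.

(** * The sum of divisors and the totient *)

Lemma leq_sum_uniq_sub (s t : seq nat) : uniq s -> {subset s <= t} ->
  (\sum_(d <- s) d <= \sum_(d <- t) d)%N.
Proof.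
move=> us st; apply: (@leq_trans (\sum_(d <- undup t) d)%N).
  apply: (@uniq_sub_le_big _ addn leq leqnn (fun x y => leq_addr y x)) => //.
    exact: undup_uniq.
  by move=> x /st; rewrite mem_undup.
apply: (@sub_le_big_seq _ addn leq leqnn (fun x y => leq_addr y x)) => x.
rewrite count_uniq_mem ?undup_uniq// mem_undup.
by case: (boolP (x \in t)) => //; rewrite -has_pred1 has_count.
Qed.

(** A divisor [d] of [a * b] is [gcdn d a] times a divisor of [b], so it occurs among the products
    of pairs of divisors. *)
Lemma sigma_coprime_leq (a b : nat) : coprime a b -> (0 < a)%N -> (0 < b)%N ->
  (sigma (a * b) <= sigma a * sigma b)%N.
Proof.
move=> cab a0 b0; rewrite /sigma.
have -> : ((\sum_(x <- divisors a) x) * (\sum_(y <- divisors b) y) =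
    \sum_(z <- [seq (x * y)%N | x <- divisors a, y <- divisors b]) z)%N.
  by rewrite big_allpairs_dep big_distrl/=; apply: eq_bigr => x _; rewrite big_distrr.
apply: leq_sum_uniq_sub (divisors_uniq _) _ => d.
rewrite -dvdn_divisors ?muln_gt0 ?a0// => dab.
apply/allpairsP; exists (gcdn d a, (d %/ gcdn d a)%N) => /=.
have g0 : (0 < gcdn d a)%N by rewrite gcdn_gt0 a0 orbT.
split; first by rewrite -dvdn_divisors// dvdn_gcdr.
  rewrite -dvdn_divisors// -(dvdn_pmul2r g0) divnK ?dvdn_gcdl//.
  rewrite muln_gcdr dvdn_gcd dvdn_mull// mulnC.
  by rewrite dab.
by rewrite mulnC divnK// dvdn_gcdl.
Qed.

(** By the geometric sum, [sigma (p ^ k)] is at most (p^(k+1) - 1)/(p - 1); the factor p - 1 of the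
    totient cancels the denominator. *)
Lemma sigma_totient_pfactor (p k : nat) : prime p -> (0 < k)%N ->
  (sigma (p ^ k) * totient (p ^ k) <= (p ^ k) ^ 2)%N.
Proof.
move=> pp k0; have p0 := prime_gt0 pp.
have h : (sigma (p ^ k) <= \sum_(i < k.+1) p ^ i)%N.
  have -> : (\sum_(i < k.+1) p ^ i = \sum_(d <- [seq p ^ i | i <- index_iota 0 k.+1]) d)%N.
    by rewrite big_map big_mkord.
  apply: leq_sum_uniq_sub (divisors_uniq _) _ => d.
  rewrite -dvdn_divisors ?expn_gt0 ?p0// => /(dvdn_pfactor _ _ pp)[m mk ->].
  by apply: map_f; rewrite mem_index_iota.
rewrite totient_pfactor// mulnA (leq_trans (leq_mul (leq_mul h (leqnn _)) (leqnn _)))//.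
rewrite [X in (X * _ <= _)%N]mulnC -predn_exp.
case: k k0 {h} => // k _ /=; rewrite -expnM -{1}(subn1 (_ ^ _)).
apply: (@leq_trans (p ^ k.+2 * p ^ k))%N; first by rewrite leq_mul2r leq_subr orbT.
by rewrite -expnD leq_exp2l ?prime_gt1//; lia.
Qed.

(** Strong induction, splitting off the full power of the least prime factor. *)
Lemma sigma_totient_leq (n : nat) : (0 < n)%N ->
  (sigma n * totient n <= n ^ 2)%N.
Proof.
elim/ltn_ind: n => n IH n0.
have [n1|n1] := leqP n 1.
  by have -> : n = 1%N; [lia | rewrite /sigma (_ : divisors 1 = [:: 1%N])// big_seq1].
have pp := pdiv_prime n1; set p := pdiv n in pp.
have [m cpm nE] := pfactor_coprime pp n0.
have k0 : (0 < logn p n)%N by rewrite logn_gt0 mem_primes pp n0 pdiv_dvd.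
have m0 : (0 < m)%N by move: n0; rewrite nE; case: (m).
have pk : (1 < p ^ logn p n)%N by rewrite -(exp1n (logn p n)) ltn_exp2r// prime_gt1.
have mn : (m < n)%N by rewrite [X in (_ < X)%N]nE ltn_Pmulr.
have cmp : coprime m (p ^ logn p n) by rewrite coprime_sym coprimeXl.
rewrite nE totient_coprime// expnMn.
apply: (@leq_trans ((sigma m * totient m) *
  (sigma (p ^ logn p n) * totient (p ^ logn p n))))%N.
  by rewrite mulnACA leq_mul// sigma_coprime_leq// (ltn_trans _ pk).
by apply: leq_mul; [exact: IH | exact: sigma_totient_pfactor].
Qed.

(** Euler's product formula for the totient, cleared of denominators and compared prime by prime. *)
Lemma totient_prod_primes (n : nat) : (0 < n)%N ->
  (totient n * \prod_(p <- primes n) p = n * \prod_(p <- primes n) p.-1)%N.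
Proof.
move=> n0; rewrite totientE// [X in _ = (X * _)%N](prod_prime_decomp n0).
rewrite prime_decompE big_map/= -!big_split/=.
rewrite [LHS]big_seq [RHS]big_seq; apply: eq_bigr => p pn.
have k0 : (0 < logn p n)%N by rewrite logn_gt0.
by rewrite -mulnA -expnSr prednK// mulnC.
Qed.

Definition primes_upto (n : nat) : seq nat := [seq p <- iota 0 n.+1 | prime p].

Lemma mem_primes_upto (n p : nat) :
  (p \in primes_upto n) = (p <= n)%N && prime p.
Proof. by rewrite mem_filter mem_iota andbC add0n ltnS. Qed.

Lemma primes_upto_uniq (n : nat) : uniq (primes_upto n).
Proof. by rewrite filter_uniq ?iota_uniq. Qed.

Lemma primes_uptoS (n : nat) : primes_upto n.+1 =
  if prime n.+1 then rcons (primes_upto n) n.+1 else primes_upto n.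
Proof.
rewrite /primes_upto -[in LHS](addn1 n.+1) iotaD filter_cat/= add0n.
by case: ifP; rewrite ?cats1 ?cats0.
Qed.

Lemma primes_uptoD (m n : nat) : primes_upto (m + n) =
  primes_upto m ++ [seq p <- iota m.+1 n | prime p].
Proof. by rewrite /primes_upto -addSn iotaD filter_cat. Qed.

(** * Euler products over finite sets of primes *)

Definition euler_prod (R : realType) (s : seq nat) : R :=
  \prod_(p <- s) (p%:R / p.-1%:R).

Lemma euler_factor_ge1 (R : realType) (p : nat) : prime p -> 1 <= p%:R / p.-1%:R :> R.
Proof.
move=> pp; have p1 := prime_gt1 pp.
by rewrite ler_pdivlMr ?ltr0n ?mul1r ?ler_nat; lia.
Qed.

Lemma euler_prod_ge1 (R : realType) (s : seq nat) : all prime s -> 1 <= euler_prod R s.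
Proof.
move=> /allP sp; rewrite /euler_prod big_seq.
by elim/big_rec: _ => // p x /sp pp x1; rewrite mulr_ege1 ?euler_factor_ge1.
Qed.

Lemma euler_prod_cat (R : realType) (s t : seq nat) :
  euler_prod R (s ++ t) = euler_prod R s * euler_prod R t.
Proof. exact: big_cat. Qed.

Lemma euler_prod_perm (R : realType) (s t : seq nat) :
  perm_eq s t -> euler_prod R s = euler_prod R t.
Proof. exact: perm_big. Qed.

Lemma all_prime_primes (n : nat) : all prime (primes n).
Proof. by apply/allP => p; rewrite mem_primes => /andP[]. Qed.

Lemma all_prime_upto (n : nat) : all prime (primes_upto n).
Proof. by apply/allP => p; rewrite mem_primes_upto => /andP[]. Qed.

Lemma euler_prodE (R : realType) (s : seq nat) : euler_prod R s =
  (\prod_(p <- s) p)%N%:R / (\prod_(p <- s) p.-1)%N%:R.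
Proof.
by rewrite /euler_prod !(big_morph _ (@natrM R) (erefl 1%:R)) prodf_div.
Qed.

Lemma prod_pred_gt0 (s : seq nat) : all prime s -> (0 < \prod_(p <- s) p.-1)%N.
Proof.
move=> /allP sp; rewrite big_seq; elim/big_rec: _ => // p x /sp/prime_gt1 p1 x0.
by rewrite muln_gt0 x0; lia.
Qed.

Lemma euler_prod_totient (R : realType) (n : nat) : (0 < n)%N ->
  euler_prod R (primes n) = n%:R / (totient n)%:R.
Proof.
move=> n0; rewrite euler_prodE; apply/eqP.
rewrite eqr_div ?pnatr_eq0 -?lt0n ?totient_gt0 ?prod_pred_gt0 ?all_prime_primes//.
by rewrite -!natrM eqr_nat mulnC totient_prod_primes.
Qed.

Lemma sigma_le_euler_prod (R : realType) (n : nat) : (0 < n)%N ->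
  (sigma n)%:R <= n%:R * euler_prod R (primes n).
Proof.
move=> n0; rewrite euler_prod_totient// mulrA ler_pdivlMr ?ltr0n ?totient_gt0//.
by rewrite -!natrM ler_nat sigma_totient_leq.
Qed.

(** * Exchanging the prime factors of n for the primes up to y *)

Section Exchange.
Variables (R : realType) (n y : nat).
Hypothesis n0 : (0 < n)%N.
Let common := [seq p <- primes n | (p <= y)%N].
Let large := [seq p <- primes n | ~~ (p <= y)%N].
Let absent := [seq p <- primes_upto y | p \notin primes n].

Lemma perm_primes_split : perm_eq (primes n) (common ++ large).
Proof. by rewrite perm_sym; apply/permPl/perm_filterC. Qed.

Lemma perm_upto_split : perm_eq (primes_upto y) (common ++ absent).
Proof.
have /permPl := perm_filterC (mem (primes n)) (primes_upto y).
rewrite perm_sym => /perm_trans; apply; rewrite perm_cat2r.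
apply: uniq_perm; rewrite ?filter_uniq ?primes_uniq ?iota_uniq// => p.
rewrite !mem_filter -/(primes_upto y) mem_iota add0n ltnS /=.
by rewrite mem_primes; case: (prime p); rewrite ?andbF//= andbC.
Qed.

Lemma all_large : all (fun p => (y < p)%N && prime p) large.
Proof.
apply/allP => p; rewrite mem_filter -ltnNge => /andP[->].
exact/allP/all_prime_primes.
Qed.

Lemma all_absent : all (fun p => (p <= y)%N && prime p) absent.
Proof. by apply/allP => p; rewrite mem_filter mem_primes_upto => /andP[]. Qed.

(** As p / (p - 1) decreases in p, it is at most (y + 1) / y for p > y and at least that for p <= y.
    With this common base, products over [large] and [absent] are compared by counting primes. *)
Lemma euler_large_le (s : seq nat) : all (fun p => (y < p)%N && prime p) s ->
  (0 < y)%N -> euler_prod R s <= (y.+1%:R / y%:R) ^+ size s.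
Proof.
move=> + y0; rewrite /euler_prod.
elim: s => [_|p s IH /= /andP[/andP[yp pp] /IH h]]; first by rewrite big_nil.
rewrite big_cons exprS ler_pM// ?divr_ge0//.
  by apply: prodr_ge0 => *; rewrite divr_ge0.
rewrite ler_pdivrMr ?ltr0n; last by have := prime_gt1 pp; lia.
rewrite mulrAC ler_pdivlMr ?ltr0n// -!natrM ler_nat; nia.
Qed.

Lemma euler_absent_ge (s : seq nat) : all (fun p => (p <= y)%N && prime p) s ->
  (y.+1%:R / y%:R) ^+ size s <= euler_prod R s.
Proof.
rewrite /euler_prod.
elim: s => [_|p s IH /= /andP[/andP[yp pp] /IH h]]; first by rewrite big_nil.
have p1 := prime_gt1 pp.
rewrite big_cons exprS ler_pM// ?divr_ge0// ?exprn_ge0 ?divr_ge0//.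
rewrite ler_pdivrMr ?ltr0n; last by lia.
rewrite mulrAC ler_pdivlMr ?ltr0n; last by lia.
rewrite -!natrM ler_nat; nia.
Qed.

Lemma prod_large_ge (s : seq nat) : all (fun p => (y < p)%N && prime p) s ->
  (y.+1 ^ size s <= \prod_(p <- s) p)%N.
Proof.
elim: s => [_|p s IH /= /andP[/andP[yp pp] /IH h]]; first by rewrite big_nil.
by rewrite big_cons expnS leq_mul.
Qed.

Lemma prod_absent_le (s : seq nat) : all (fun p => (p <= y)%N && prime p) s ->
  (\prod_(p <- s) p <= y ^ size s)%N.
Proof.
elim: s => [_|p s IH /= /andP[/andP[yp pp] /IH h]]; first by rewrite big_nil.
by rewrite big_cons expnS leq_mul.
Qed.

Lemma prod_primes_leq : (\prod_(p <- primes n) p <= n)%N.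
Proof.
rewrite [X in (_ <= X)%N](prod_prime_decomp n0) prime_decompE big_map/=.
rewrite big_seq [X in (_ <= X)%N]big_seq; apply: leq_prod => p pn.
by rewrite -{1}(expn1 p) leq_pexp2l ?logn_gt0//; move: pn; rewrite mem_primes => /andP[/prime_gt0].
Qed.

(* If [n] is below [y.+1] times the primorial of [y], it cannot trade primes
   [<= y] for a larger number of primes [> y]. *)
Lemma euler_prod_primorial :
  (n < y.+1 * \prod_(p <- primes_upto y) p)%N ->
  euler_prod R (primes n) <= euler_prod R (primes_upto y).
Proof.
move=> ny; rewrite (euler_prod_perm _ _ _ perm_primes_split).
rewrite (euler_prod_perm _ _ _ perm_upto_split) !euler_prod_cat.
have c1 : 1 <= euler_prod R common.
  by apply: euler_prod_ge1; apply/allP => p; rewrite mem_filter => /andP[_ /(allP (all_prime_primes n))].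
rewrite ler_pM2l ?(lt_le_trans ltr01)//.
have [lcb|lbc] := leqP (size large) (size absent).
  (* At [y = 0] the quotient (y + 1) / y takes the default value 0; but then [absent] is empty,
     hence so is [large]. *)
  have [y0|y0] := posnP y.
    have : size absent = 0%N by rewrite /absent y0.
    by move: lcb => /[swap] ->; rewrite leqn0 => /nilP ->; rewrite /absent y0.
  apply: le_trans (euler_large_le _ all_large y0) (le_trans _ (euler_absent_ge _ all_absent)).
  by rewrite ler_weXn2l// ler_pdivlMr ?ltr0n// mul1r ler_nat.
(* With more [large] primes than [absent] ones, y + 1 times the product over [absent] is at most the
   product over [large], so n would reach y + 1 times the primorial. *)
exfalso; move: ny; apply/negP; rewrite -leqNgt.
apply: leq_trans prod_primes_leq.
rewrite (perm_big _ perm_upto_split) (perm_big _ perm_primes_split)/= !big_cat/=.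
rewrite mulnCA leq_mul2l; apply/orP; right.
apply: leq_trans (prod_large_ge _ all_large).
apply: (@leq_trans (y.+1 ^ (size absent).+1)); last by rewrite leq_pexp2l.
rewrite expnS leq_mul2l (leq_trans (prod_absent_le _ all_absent))//.
by case: (size absent) => // k; rewrite leq_exp2r.
Qed.

(** Here m counts the prime factors of n above y. Inserting the absent primes only enlarges the
    Euler product, and the m large primes have product at most n. *)
Lemma euler_prod_split : (0 < y)%N -> exists2 m : nat,
  euler_prod R (primes n) <= euler_prod R (primes_upto y) * (y.+1%:R / y%:R) ^+ m &
  (y.+1 ^ m <= n)%N.
Proof.
move=> y0; exists (size large).
  rewrite (euler_prod_perm _ _ _ perm_primes_split).
  rewrite (euler_prod_perm _ _ _ perm_upto_split) !euler_prod_cat.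
  have c1 : 1 <= euler_prod R common.
    by apply: euler_prod_ge1; apply/allP => p; rewrite mem_filter => /andP[_ /(allP (all_prime_primes n))].
  rewrite -mulrA ler_pM2l ?(lt_le_trans ltr01)//.
  apply: le_trans (euler_large_le _ all_large y0) _; rewrite ler_peMl ?exprn_ge0 ?divr_ge0//.
  by apply: euler_prod_ge1; apply: sub_all all_absent => p /andP[].
apply: leq_trans prod_primes_leq; apply: leq_trans (prod_large_ge _ all_large) _.
rewrite [X in (_ <= X)%N](perm_big _ perm_primes_split)/= big_cat/= leq_pmull//.
rewrite big_seq prodn_cond_gt0// => p; rewrite mem_filter => /andP[_].
by move=> /(allP (all_prime_primes n))/prime_gt0.
Qed.

End Exchange.

(** * Numerical bounds and Euler's constant *)

Fixpoint posR (R : realType) (p : positive) : R :=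
  match p with
  | xH => 1
  | xO p => 2 * posR R p
  | xI p => 2 * posR R p + 1
  end.

(* Binary evaluation: it simplifies without going through unary numbers. *)
Definition NR (R : realType) (n : N) : R := if n is Npos p then posR R p else 0.

Lemma NRE (R : realType) (n : N) : NR R n = (N.to_nat n)%:R.
Proof.
case: n => //=; elim=> [p IH|p IH|//] /=; rewrite IH -natrM ?natr1; congr _%:R; lia.
Qed.

Lemma natr_div_le (R : realType) (a b : N) :
  (N.to_nat (a / b)%num)%:R <= (N.to_nat a)%:R / (N.to_nat b)%:R :> R.
Proof.
have [b0|b0] := posnP (N.to_nat b).
  by have -> : b = 0%num by [lia]; rewrite invr0 mulr0; case: a.
by rewrite ler_pdivlMr ?ltr0n// -natrM ler_nat N_divM.
Qed.

(** Fixed-point arithmetic: [a] stands for a / s, which is squared m times and rounded down each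
    time. *)
Fixpoint sqr_chain (s : N) (m : nat) (a : N) : N :=
  if m is m'.+1 then sqr_chain s m' (a * a / s) else a.

Lemma sqr_chain_le (R : realType) (s : N) (m : nat) (a : N) (x : R) : 0 <= x ->
  (N.to_nat a)%:R <= x * (N.to_nat s)%:R ->
  (N.to_nat (sqr_chain s m a))%:R <= x ^+ (2 ^ m) * (N.to_nat s)%:R.
Proof.
elim: m a x => [|m IH] a x x0 h /=; first by rewrite expn0 expr1.
rewrite expnS exprM; apply: IH; first exact: exprn_ge0.
apply: le_trans (natr_div_le _ _ _) _.
have [s0|s0] := posnP (N.to_nat s); first by rewrite s0 invr0 !mulr0.
rewrite ler_pdivrMr ?ltr0n// N_mul natrM -mulrA -expr2 -exprMn expr2.
by rewrite ler_pM.
Qed.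

(** From [1 + t <= expR t] at t = - u / k, raised to the power 2^m, exp(- u / w) is at least (1 - u
    / k)^(2^m); inverting gives an upper bound for exp(u / w). *)
Lemma expR_frac_le (R : realType) (m : nat) (s u w a b : N) :
  let k := (2 ^ N.of_nat m * w)%num in
  N.ltb u k -> N.ltb 0 s ->
  N.leb (s * b) (a * sqr_chain s m (s * (k - u) / k)) ->
  expR (NR R u / NR R w) * NR R b <= NR R a.
Proof.
move=> k uk s0 h; rewrite !NRE.
have kE : (N.to_nat k)%:R = 2 ^+ m * (N.to_nat w)%:R * 1 ^+ m :> R.
  by rewrite N_mul N_exp Nat2N.id natrM natrX expr1n mulr1.
rewrite expr1n mulr1 in kE.
have k0 : 0 < (N.to_nat k)%:R :> R by rewrite ltr0n; lia.
have w0 : 0 < (N.to_nat w)%:R :> R by move: k0; rewrite kE pmulr_rgt0// exprn_gt0.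
pose x : R := (N.to_nat (k - u))%:R / (N.to_nat k)%:R.
have x0 : 0 <= x by rewrite divr_ge0.
have xe : x ^+ (2 ^ m) <= expR (- ((N.to_nat u)%:R / (N.to_nat w)%:R)).
  have -> : - ((N.to_nat u)%:R / (N.to_nat w)%:R) =
      (2 ^ m)%N%:R * (- ((N.to_nat u)%:R / (N.to_nat k)%:R)) :> R.
    rewrite kE natrX; field.
    by rewrite (lt0r_neq0 w0) expf_neq0.
  rewrite expRM_natl lerXn2r ?nnegrE ?expR_ge0//.
  apply: le_trans (expR_ge1Dx _); rewrite /x N2Nat.inj_sub natrB; last by lia.
  by rewrite mulrBl divff ?lt0r_neq0.
have hx : (N.to_nat (s * (k - u) / k))%:R <= x * (N.to_nat s)%:R.
  by apply: le_trans (natr_div_le _ _ _) _; rewrite N_mul natrM /x mulrAC mulrC mulrA mulrAC.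
have := @sqr_chain_le R s m _ x x0 hx.
move/N_leq: h; rewrite -(ler_nat R) !N_mul !natrM.
set c := (N.to_nat (sqr_chain _ _ _))%:R; rewrite expRN in xe * => h1 h2.
have S0 : 0 < (N.to_nat s)%:R :> R by rewrite ltr0n; lia.
set e := expR _ in xe *; have e0 : 0 < e by exact: expR_gt0.
rewrite -(ler_pM2l S0).
apply: (@le_trans _ _ (e * ((N.to_nat a)%:R * c))).
  by rewrite mulrCA ler_pM2l.
rewrite mulrCA [leRHS]mulrC ler_wpM2l//.
apply: (@le_trans _ _ (e * (x ^+ (2 ^ m) * (N.to_nat s)%:R))); first by rewrite ler_pM2l.
rewrite mulrA ler_piMl ?(ltW S0)//.
by rewrite -(mulfV (lt0r_neq0 e0)) ler_pM2l.
Qed.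

(** The same approximation with the sign of t reversed: exp(u / w) is at least (1 + u / k)^(2^m). *)
Lemma expR_frac_ge (R : realType) (m : nat) (s u w a b : N) :
  let k := (2 ^ N.of_nat m * w)%num in
  N.ltb 0 w -> N.ltb 0 s ->
  N.leb (s * a) (b * sqr_chain s m (s * (k + u) / k)) ->
  NR R a <= expR (NR R u / NR R w) * NR R b.
Proof.
move=> k w0' s0 h; rewrite !NRE.
have kE : (N.to_nat k)%:R = 2 ^+ m * (N.to_nat w)%:R :> R.
  by rewrite N_mul N_exp Nat2N.id natrM natrX.
have w0 : 0 < (N.to_nat w)%:R :> R by rewrite ltr0n; lia.
have k0 : 0 < (N.to_nat k)%:R :> R by rewrite kE pmulr_rgt0// exprn_gt0.
pose x : R := (N.to_nat (k + u))%:R / (N.to_nat k)%:R.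
have x0 : 0 <= x by rewrite divr_ge0.
have xe : x ^+ (2 ^ m) <= expR ((N.to_nat u)%:R / (N.to_nat w)%:R).
  have -> : (N.to_nat u)%:R / (N.to_nat w)%:R =
      (2 ^ m)%N%:R * ((N.to_nat u)%:R / (N.to_nat k)%:R) :> R.
    rewrite kE natrX; field.
    by rewrite (lt0r_neq0 w0) expf_neq0.
  rewrite expRM_natl lerXn2r ?nnegrE ?expR_ge0//.
  apply: le_trans (expR_ge1Dx _); rewrite /x N2Nat.inj_add natrD.
  by rewrite mulrDl divff ?lt0r_neq0.
have hx : (N.to_nat (s * (k + u) / k))%:R <= x * (N.to_nat s)%:R.
  by apply: le_trans (natr_div_le _ _ _) _; rewrite N_mul natrM /x mulrAC mulrC mulrA mulrAC.
have := @sqr_chain_le R s m _ x x0 hx.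
move/N_leq: h; rewrite -(ler_nat R) !N_mul !natrM.
set c := (N.to_nat (sqr_chain _ _ _))%:R => h1 h2.
have S0 : 0 < (N.to_nat s)%:R :> R by rewrite ltr0n; lia.
rewrite -(ler_pM2l S0); apply: le_trans h1 _.
rewrite mulrA [leRHS]mulrC ler_wpM2l//; apply: le_trans h2 _.
by rewrite mulrC ler_pM2l.
Qed.

(** Below ln 2 = 0.69314... by slightly more than (ln 2)^2 / 2^11, the approximate error of the
    exponential with 2^10 factors. *)
Definition ln2_low (R : realType) : R := 6929 / 10000.

Lemma ln2_ge (R : realType) : ln2_low R <= ln 2 :> R.
Proof.
rewrite /ln2_low.
rewrite -ler_expR lnK ?posrE//.
have h : is_true (N.leb (10 ^ 12 * 1) (2 * sqr_chain (10 ^ 12) 10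
    (10 ^ 12 * (2 ^ N.of_nat 10 * 10000 - 6929) / (2 ^ N.of_nat 10 * 10000)))).
  by vm_compute.
have := expR_frac_le R 10 (10 ^ 12) 6929 10000 2 1 isT isT h.
have -> : NR R 6929 = 6929 by rewrite /NR /=; ring.
have -> : NR R 10000 = 10000 by rewrite /NR /=; ring.
by rewrite /NR /= !mulr1.
Qed.

Lemma ln2_le (R : realType) : ln 2 <= 6933 / 10000 :> R.
Proof.
rewrite -ler_expR lnK ?posrE//.
have h : is_true (N.leb (10 ^ 12 * 2) (1 * sqr_chain (10 ^ 12) 12
    (10 ^ 12 * (2 ^ N.of_nat 12 * 10000 + 6933) / (2 ^ N.of_nat 12 * 10000)))).
  by vm_compute.
have := expR_frac_ge R 12 (10 ^ 12) 6933 10000 2 1 isT isT h.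
have -> : NR R 6933 = 6933 by rewrite /NR /=; ring.
have -> : NR R 10000 = 10000 by rewrite /NR /=; ring.
by rewrite /NR /= !mulr1.
Qed.

Lemma expR_572_ge (R : realType) : 177 / 100 <= expR (572 / 1000) :> R.
Proof.
have h : is_true (N.leb (10 ^ 12 * 177) (100 * sqr_chain (10 ^ 12) 10
    (10 ^ 12 * (2 ^ N.of_nat 10 * 1000 + 572) / (2 ^ N.of_nat 10 * 1000)))).
  by vm_compute.
have := expR_frac_ge R 10 (10 ^ 12) 572 1000 177 100 isT isT h.
have -> : NR R 572 = 572 by rewrite /NR /=; ring.
have -> : NR R 1000 = 1000 by rewrite /NR /=; ring.
have -> : NR R 177 = 177 by rewrite /NR /=; ring.
have -> : NR R 100 = 100 by rewrite /NR /=; ring.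
by move: (expR _) => e he; lra.
Qed.

(** Every quotient is rounded down. A constant weight serves the harmonic sum, logarithmic weights
    serve the sum of ln p / p. *)
Definition sum_div (w : N -> N) (s : seq N) : N :=
  foldr (fun k acc => w k / k + acc)%num 0%num s.

Lemma sum_div_le (R : realType) (w : N -> N) (s : seq N) :
  (N.to_nat (sum_div w s))%:R <=
  \sum_(k <- s) (N.to_nat (w k))%:R / (N.to_nat k)%:R :> R.
Proof.
elim: s => [|k s IH] /=; first by rewrite big_nil.
by rewrite big_cons N2Nat.inj_add natrD lerD// natr_div_le.
Qed.

Lemma harmonic_ge (R : realType) (a b c : N) (n : nat) : N.ltb 0 c ->
  N.leb (a * c) (b * sum_div (fun=> c) (map N.of_nat (iota 1 n))) ->
  NR R a <= NR R b * \sum_(1 <= k < n.+1) k%:R^-1.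
Proof.
move=> c0 /N_leq; rewrite !N_mul -(ler_nat R) !natrM => h; rewrite !NRE.
have C0 : 0 < (N.to_nat c)%:R :> R by rewrite ltr0n; lia.
rewrite -(ler_pM2r C0); apply: le_trans h _; rewrite -mulrA ler_wpM2l//.
apply: le_trans (sum_div_le _ _ _) _.
rewrite big_map mulrC mulr_sumr /index_iota subSS subn0.
by rewrite le_eqVlt; apply/orP; left; apply/eqP/eq_bigr => i _; rewrite Nat2N.id.
Qed.

(** [euler_seq] tends to its limit from above, so the bound comes from the increasing companion H_m
    - ln(m + 1), which lies below it. *)
Lemma euler_gamma_ge (R : realType) : 572 / 1000 <= euler_gamma R.
Proof.
have H255 : 612 / 100 <= \sum_(1 <= k < 256) k%:R^-1 :> R.
  have e : is_true (N.leb (612 * 10 ^ 6) (100 * sum_div (fun=> 10 ^ 6)%num (map N.of_nat (iota 1 255)))).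
    by vm_compute.
  have := harmonic_ge R 612 100 (10 ^ 6) 255 isT e.
  have -> : NR R 612 = 612 by rewrite /NR /=; ring.
  have -> : NR R 100 = 100 by rewrite /NR /=; ring.
  by move: (\sum_(_ <= _ < _) _) => t ht; lra.
apply: limr_ge; first exact: is_cvg_euler_seq.
near=> n.
have n255 : (255 <= n)%N by near: n; exact: nbhs_infty_ge.
(* At m = 255 the logarithm is 8 ln 2, and 6.12 - 8 * 0.6933 exceeds 0.572. *)
pose u m : R := \sum_(1 <= k < m.+1) k%:R^-1 - ln m.+1%:R.
have u255 m : (255 <= m)%N -> u 255%N <= u m.
  elim: m => // m IH; rewrite leq_eqVlt => /orP[/eqP<-//|].
  rewrite ltnS => /IH /le_trans; apply; rewrite /u [in leRHS]big_nat_recr//=.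
  rewrite -addrA lerD2l lerBrDr.
  have -> : m.+2%:R = m.+1%:R * (1 + m.+1%:R^-1) :> R.
    by rewrite mulrDr mulr1 mulfV ?pnatr_eq0// natr1.
  have m0 : 0 < m.+1%:R^-1 :> R by rewrite invr_gt0 ltr0n.
  rewrite lnM ?posrE ?ltr0n// ?addr_gt0// addKr.
  by apply: le_ln1Dx; rewrite (lt_trans _ m0)// ltrN10.
have un : u n <= euler_seq R n.
  by rewrite /u /euler_seq lerD2l lerN2 ler_ln ?posrE ?ltr0n ?ler_nat// (leq_trans _ n255).
apply: le_trans un; apply: le_trans (u255 _ n255); rewrite /u.
have -> : (256%:R : R) = 2 ^+ 8 by rewrite -natrX.
rewrite lnXn// -[ln 2 *+ 8]mulr_natl.
have := ln2_le R; move: H255; move: (\sum_(_ <= _ < _) _) => S; move: (ln 2) => l h1 h2; lra.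
Unshelve. all: by end_near.
Qed.

(** The value 1.77 turns the factor 2/3 of the theorem into 1.18, the constant of the finite checks;
    2.36 is its double. *)
Lemma expR_gamma_ge (R : realType) : 177 / 100 <= expR (euler_gamma R).
Proof. by apply: le_trans (expR_572_ge R) _; rewrite ler_expR euler_gamma_ge. Qed.

(** * Lower bounds for logarithms and iterated logarithms *)

Lemma ln_ge_log2 (R : realType) (x : R) (j k : nat) : (0 < k)%N -> 0 < x ->
  2 ^+ j <= x ^+ k -> j%:R / k%:R * ln 2 <= ln x.
Proof.
move=> k0 x0 h; rewrite mulrAC ler_pdivrMr ?ltr0n// mulr_natl mulr_natr.
by rewrite -!lnXn// ler_ln ?posrE ?exprn_gt0.
Qed.

(* A lower bound for [2 ^ m * log2 (a / s)]: the binary digits of the logarithm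
   are produced by repeated squaring of the mantissa, rounded down. *)
Fixpoint log2_lb (s : N) (m : nat) (a : N) : N :=
  let e := N.log2 (a / s) in
  if m is m'.+1 then
    let a' := (a / 2 ^ e)%num in (2 ^ N.of_nat m * e + log2_lb s m' (a' * a' / s))%num
  else e.

Lemma log2_lbS (s : N) (m : nat) (a : N) :
  let b := (a / 2 ^ N.log2 (a / s))%num in log2_lb s m.+1 a =
  (2 ^ N.of_nat m.+1 * N.log2 (a / s) + log2_lb s m (b * b / s))%num.
Proof. by []. Qed.

(** With x = 2^e z, the power x^(2^(m+1)) is 2^(2^(m+1) e) times (z^2)^(2^m), and the recursion
    continues with z^2. The invariant s <= a keeps the mantissa at least 1, as the integer logarithm
    requires. *)
Lemma log2_lb_le (R : realType) (s : N) (m : nat) (a : N) (x : R) :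
  N.ltb 0 s -> N.leb s a -> (N.to_nat a)%:R <= x * (N.to_nat s)%:R ->
  2 ^+ N.to_nat (log2_lb s m a) <= x ^+ (2 ^ m).
Proof.
move=> s0; have s0' : (0 < N.to_nat s)%N by lia.
have S0 : 0 < (N.to_nat s)%:R :> R by rewrite ltr0n.
have key b : N.leb s b -> (2 ^ N.to_nat (N.log2 (b / s)) * N.to_nat s <= N.to_nat b)%N.
  move=> sb; apply: leq_trans (N_divM b s); rewrite leq_mul2r N_log2 ?orbT//.
  have := N.div_le_mono s b s; have := N.div_same s; lia.
elim: m a x => [|m IH] a x sa h.
  rewrite expn0 expr1 /= -(ler_pM2r S0); apply: le_trans h.
  by rewrite -natrX -natrM ler_nat key.
rewrite log2_lbS; set e := N.log2 _; set b := (a / 2 ^ e)%num.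
have e0 : 0 < 2 ^+ N.to_nat e :> R by rewrite exprn_gt0.
have sb : N.leb s b.
  apply/N.leb_le/N.div_le_lower_bound; first exact: N.pow_nonzero.
  have := key a sa; rewrite -/e; have := N_exp 2 e; rewrite (_ : N.to_nat 2 = 2%N)//.
  move=> <-; rewrite -N_mul; lia.
have bx : (N.to_nat b)%:R <= x / 2 ^+ N.to_nat e * (N.to_nat s)%:R.
  apply: le_trans (natr_div_le _ _ _) _.
  by rewrite N_exp natrX (_ : N.to_nat 2 = 2%N)// mulrAC ler_wpM2r ?invr_ge0 ?(ltW e0).
rewrite N2Nat.inj_add N_mul N_exp Nat2N.id (_ : N.to_nat 2 = 2%N)//.
have bbx : (N.to_nat (b * b / s))%:R <= (x / 2 ^+ N.to_nat e) ^+ 2 * (N.to_nat s)%:R.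
  apply: le_trans (natr_div_le _ _ _) _.
  rewrite ler_pdivrMr// N_mul natrM -mulrA -expr2 -exprMn expr2.
  by rewrite ler_pM.
have sbb : N.leb s (b * b / s).
  by apply/N.leb_le/N.div_le_lower_bound; nia.
have := IH _ _ sbb bbx; rewrite -exprM -expnS expr_div_n -exprM.
by rewrite ler_pdivlMr ?exprn_gt0// -exprD addnC mulnC.
Qed.

(** When j / 256 is a lower bound for log2 x, the fixed-point number j * 6929 over 256 * 10000 is
    one for ln x; the result over 256 is one for the binary logarithm of ln x. *)
Definition lnln_lb (j : N) : N := log2_lb (256 * 10000) 8 (j * 6929).

Lemma lnln_ge (R : realType) (x : R) (j : N) : N.leb (256 * 10000) (j * 6929) ->
  (N.to_nat j)%:R / 256 * ln 2 <= ln x ->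
  (N.to_nat (lnln_lb j))%:R / 256 * ln2_low R <= ln (ln x).
Proof.
move=> j1 h; have j0 : (0 < N.to_nat j)%N by lia.
move: j1; have c0 : 0 < ln2_low R by rewrite /ln2_low; lra.
have [r rE] : {r : R | r = (N.to_nat j)%:R / 256 * ln2_low R} by eexists.
have jk0 : 0 < (N.to_nat j)%:R / 256 :> R by rewrite divr_gt0 ?ltr0n.
have r0 : 0 < r by rewrite rE mulr_gt0.
have rx : r <= ln x.
  by apply: le_trans h; rewrite rE; apply: ler_wpM2l (ln2_ge R); exact: ltW.
suff h1 : N.leb (256 * 10000) (j * 6929) -> (N.to_nat (lnln_lb j))%:R / 256 * ln 2 <= ln r.
  move=> /h1; move: (N.to_nat (lnln_lb j)) => t {}h1.
  apply: le_trans (le_trans _ h1) _.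
    have t0 : 0 <= t%:R / 256 :> R by apply: divr_ge0; exact: ler0n.
  exact: ler_wpM2l t0 _ _ (ln2_ge R).
  by rewrite ler_ln ?posrE// (lt_le_trans r0).
have hr : (N.to_nat (j * 6929))%:R = r * (N.to_nat (256 * 10000))%:R.
  rewrite (N_mul 256 10000) (N_mul j 6929) !natrM -(NRE R 256) -(NRE R 10000) -(NRE R 6929).
  have -> : NR R 256 = 256 by rewrite /NR /=; ring.
  have -> : NR R 10000 = 10000 by rewrite /NR /=; ring.
  have -> : NR R 6929 = 6929 by rewrite /NR /=; ring.
  by rewrite rE /ln2_low; field.
move=> j1; apply: (@ln_ge_log2 _ r _ 256) => //.
by apply: (@log2_lb_le _ (256 * 10000) 8 (j * 6929)) => //; rewrite hr.
Qed.

(** * Mertens' theorems with explicit constants *)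

Lemma prod_primes_dvdn (s : seq nat) (m : nat) : uniq s -> all prime s ->
  all (fun p => p %| m)%N s -> (\prod_(p <- s) p %| m)%N.
Proof.
elim: s => [|p s IH] /=; first by rewrite big_nil dvd1n.
move=> /andP[ps us] /andP[pp sp] /andP[pm sm]; rewrite big_cons.
suff cop : coprime p (\prod_(q <- s) q) by rewrite Gauss_dvd// pm IH.
rewrite prime_coprime// big_seq.
elim/big_rec: _ => [|q x qs]; first by rewrite dvdn1; case: p pp {ps pm} => [|[]].
rewrite Euclid_dvdM// negb_or => ->; rewrite andbT dvdn_prime2 ?(allP sp q qs)//.
by apply/eqP => pq; move: ps; rewrite pq qs.
Qed.

(** The coefficient occurs twice, at m and at m + 1, in the binomial expansion of 2^(2m+1). *)
Lemma bin_mid_leq (m : nat) : ('C(m.*2.+1, m) <= 4 ^ m)%N.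
Proof.
rewrite -(leq_pmul2l (isT : 0 < 2)%N).
have -> : (2 * 4 ^ m = 2 ^ m.*2.+1)%N.
  by rewrite expnS -mul2n expnM.
rewrite -[X in (X ^ _)%N](addn1 1) expnDn.
have e : 'C(m.*2.+1, m.+1) = 'C(m.*2.+1, m).
  by rewrite -bin_sub; [congr binomial|]; lia.
have hm : (m < m.*2.+2)%N by lia.
have hm1 : (m.+1 < m.*2.+2)%N by lia.
rewrite (bigD1 (Ordinal hm))//= (bigD1 (Ordinal hm1))/=; last first.
  by rewrite -val_eqE/= neq_ltn ltnSn orbT.
by rewrite !exp1n !muln1 e mul2n -addnn addnA leq_addr.
Qed.

(** Erdos's induction: an even n > 2 adds no prime, and for n = 2m + 1 the primes in (m + 1, 2m + 1]
    divide the central binomial coefficient. *)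
Lemma primorial_leq (n : nat) : (\prod_(p <- primes_upto n) p <= 4 ^ n)%N.
Proof.
elim/ltn_ind: n => n IH.
have [n2|n2] := leqP n 2.
  by case: n n2 {IH} => [|[|[|]]]//= _; rewrite /primes_upto/= ?big_nil ?big_seq1.
have [on|en] := boolP (odd n); last first.
  case: n n2 en IH => // n n2 en IH.
  have np : ~~ prime n.+1.
    by apply: contra en => /even_prime[|//]; lia.
  rewrite primes_uptoS (negbTE np); apply: leq_trans (IH _ (ltnSn _)) _.
  by rewrite leq_exp2l.
have nE : n = n./2.*2.+1 by rewrite -[LHS]odd_double_half on.
set m := n./2 in nE; have nm : n = (m.+1 + m)%N by lia.
rewrite [in primes_upto n]nm primes_uptoD big_cat/=.
apply: (@leq_trans (4 ^ m.+1 * 4 ^ m)%N); last by rewrite -expnD -nm.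
apply: leq_mul; first by apply: IH; lia.
apply: leq_trans (bin_mid_leq m); apply: dvdn_leq; first by rewrite bin_gt0; lia.
apply: prod_primes_dvdn; rewrite ?filter_uniq ?iota_uniq//.
  by apply/allP => p; rewrite mem_filter => /andP[].
apply/allP => p; rewrite mem_filter mem_iota => /and3P[pp p1 p2].
have pf k : (p %| k`!)%N -> (p <= k)%N.
  elim: k => [|k IHk]; first by rewrite fact0 dvdn1; case: p pp {p1 p2} => [|[]].
  by rewrite factS Euclid_dvdM// => /orP[/dvdn_leq->//|/IHk/leqW].
have : (p %| 'C(m.*2.+1, m) * (m`! * (m.*2.+1 - m)`!))%N.
  by rewrite bin_fact ?dvdn_fact//; lia.
by rewrite !Euclid_dvdM// => /orP[//|/orP[/pf|/pf]]; lia.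
Qed.

(** A weak Stirling bound; the induction step is ln(n + 1) - ln n >= 1 / (n + 1). *)
Lemma ln_fact_le (R : realType) (n : nat) : (0 < n)%N ->
  ln n`!%:R <= n%:R * ln n%:R - n%:R + 1 + ln n%:R :> R.
Proof.
elim: n => // n IH _; have [->|n0] := posnP n.
  by rewrite factS fact0 ln1 mulr0 sub0r addNr addr0.
rewrite factS natrM lnM ?posrE ?ltr0n ?fact_gt0//.
have := IH n0; set L := ln n%:R; set M := ln n.+1%:R.
have h : 1 <= n.+1%:R * (M - L).
  rewrite -ler_pdivrMl ?ltr0n// mulr1.
  have := @le_ln1Dx R (- n.+1%:R^-1).
  have -> : 1 - n.+1%:R^-1 = n%:R / n.+1%:R :> R.
    apply/eqP; rewrite subr_eq -[X in _ + X]mul1r -mulrDl natr1.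
    by rewrite mulfV ?pnatr_eq0.
  rewrite ltrN2 invf_lt1 ?ltr0n// ltr1n => /(_ n0).
  by rewrite ln_div ?posrE ?ltr0n// lerNr opprB.
move: h; rewrite -natr1; move: (n%:R) => x; nra.
Qed.

Lemma mem_primes_fact (n p : nat) : (p \in primes n`!) = (p \in primes_upto n).
Proof.
rewrite mem_primes mem_primes_upto fact_gt0 andbC/=.
apply/andP/andP => -[h pp]; split=> //; last by rewrite dvdn_fact// prime_gt0.
elim: n h => [|k IHk]; first by rewrite fact0 dvdn1; case: p pp => [|[]].
by rewrite factS Euclid_dvdM// => /orP[/dvdn_leq->//|/IHk/leqW].
Qed.

Lemma ln_factE (R : realType) (n : nat) :
  ln n`!%:R = \sum_(p <- primes_upto n) (logn p n`!)%:R * ln p%:R :> R.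
Proof.
rewrite [X in X%:R](prod_prime_decomp (fact_gt0 n)) prime_decompE big_map/=.
rewrite (perm_big (primes_upto n)); last first.
  by apply: uniq_perm; rewrite ?primes_uniq ?primes_upto_uniq// => p; rewrite mem_primes_fact.
have : all prime (primes_upto n) by exact: all_prime_upto.
elim: (primes_upto n) => [|p s IH] /=; first by rewrite !big_nil ln1.
move=> /andP[pp sp]; rewrite !big_cons natrM natrX lnM ?posrE.
- by rewrite IH// lnXn ?ltr0n ?prime_gt0// mulr_natl.
- by rewrite exprn_gt0// ltr0n prime_gt0.
by rewrite ltr0n big_seq prodn_cond_gt0// => q qs; rewrite expn_gt0 prime_gt0// (allP sp).
Qed.

Lemma natr_divn_ge (R : realType) (n d : nat) : (0 < d)%N ->
  n%:R / d%:R - 1 <= (n %/ d)%:R :> R.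
Proof.
move=> d0; rewrite lerBlDr natr1 ler_pdivrMr ?ltr0n// -natrM ler_nat ltnW//.
by rewrite ltn_ceil.
Qed.

(** Legendre's formula cut after the j-th power, each floor costing at most 1. *)
Lemma logn_fact_ge (R : realType) (n p j : nat) : prime p -> (j <= n)%N ->
  \sum_(1 <= k < j.+1) (n%:R / (p ^ k)%:R - 1) <= (logn p n`!)%:R :> R.
Proof.
move=> pp jn; rewrite logn_fact// (@big_cat_nat nat 0%N addn j.+1)//= natrD.
apply: (@le_trans _ _ (\sum_(1 <= k < j.+1) n %/ p ^ k)%N%:R); last by rewrite lerDl.
rewrite natr_sum; apply: ler_sum => k _.
by rewrite natr_divn_ge// expn_gt0 prime_gt0.
Qed.

Lemma ln_natr_ge0 (R : realType) (p : nat) : 0 <= ln p%:R :> R.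
Proof. by case: p => [|p]; [rewrite ln0 | rewrite ln_ge0// ler1n]. Qed.

Definition mertens_sum (R : realType) (n : nat) : R :=
  \sum_(p <- primes_upto n) ln p%:R / p%:R.

(* Contribution of the prime powers [p ^ 2, ..., p ^ 6] with [p <= 7] to
   [ln n`! / n]. *)
Definition higher_powers (R : realType) : R :=
  \sum_(p <- [:: 2; 3; 5; 7]%N) ln p%:R * \sum_(2 <= k < 7) (p ^ k)%:R^-1.

(** Legendre's formula is kept to the sixth power for p <= 7 and to the first power otherwise. The
    floors of the first powers cost the logarithm of the primorial, at most n ln 4; those of the
    higher powers cost 5 ln p for each p <= 7. *)
Lemma mertens_sum_fact_le (R : realType) (n : nat) : (7 <= n)%N ->
  n%:R * mertens_sum R n - n%:R * (2 * ln 2) + n%:R * higher_powers R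
    - 5 * \sum_(p <- [:: 2; 3; 5; 7]%N) ln p%:R <= ln n`!%:R.
Proof.
move=> n7; rewrite ln_factE.
pose ext p : R := \sum_(2 <= k < 7) (n%:R / (p ^ k)%:R - 1).
have lo p : prime p -> (n%:R / p%:R - 1 + (if (p <= 7)%N then ext p else 0)) * ln p%:R <=
    (logn p n`!)%:R * ln p%:R :> R.
  move=> pp; rewrite ler_wpM2r ?ln_natr_ge0//.
  case: ifP => _; last first.
    by have := @logn_fact_ge R n p 1 pp (leq_trans _ n7); rewrite big_nat1 expn1 addr0; apply.
  have := @logn_fact_ge R n p 6 pp (leq_trans _ n7).
  by rewrite big_ltn// expn1; apply.
apply: (@le_trans _ _ (\sum_(p <- primes_upto n)
   (n%:R / p%:R - 1 + (if (p <= 7)%N then ext p else 0)) * ln p%:R)); last first.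
  rewrite big_seq [leRHS]big_seq; apply: ler_sum => p.
  by rewrite mem_primes_upto => /andP[_ /lo].
have theta : \sum_(p <- primes_upto n) ln p%:R <= n%:R * (2 * ln 2) :> R.
  have -> : \sum_(p <- primes_upto n) ln p%:R = ln (\prod_(p <- primes_upto n) p)%N%:R :> R.
    have := all_prime_upto n; elim: (primes_upto n) => [|p s IH] /=.
      by rewrite !big_nil ln1.
    move=> /andP[pp sp]; have P0 : (0 < \prod_(q <- s) q)%N.
      by rewrite big_seq prodn_cond_gt0// => q qs; rewrite prime_gt0// (allP sp).
    by rewrite !big_cons natrM lnM ?posrE ?ltr0n ?(prime_gt0 pp)// IH.
  have -> : n%:R * (2 * ln 2) = ln (4 ^ n)%N%:R :> R.
    rewrite natrX lnXn// (natrM R 2 2) lnM ?posrE// [in RHS]mulrnDl.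
    by rewrite mulr_natl [in LHS]mulrDl mul1r mulrnDl.
  have P0 : (0 < \prod_(p <- primes_upto n) p)%N.
    by rewrite big_seq prodn_cond_gt0// => q; rewrite mem_primes_upto => /andP[_ /prime_gt0].
  by rewrite ler_ln ?posrE ?ltr0n ?expn_gt0// ler_nat primorial_leq.
have -> : \sum_(p <- primes_upto n)
   (n%:R / p%:R - 1 + (if (p <= 7)%N then ext p else 0)) * ln p%:R =
   n%:R * mertens_sum R n - \sum_(p <- primes_upto n) ln p%:R +
   \sum_(p <- [:: 2; 3; 5; 7]%N) ext p * ln p%:R.
  under eq_bigr do rewrite mulrDl.
  rewrite big_split/=; congr (_ + _).
    rewrite /mertens_sum mulr_sumr -sumrB; apply: eq_bigr => p _.
    by rewrite mulrBl mul1r mulrA mulrAC.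
  have -> : n = (7 + (n - 7))%N by lia.
  rewrite primes_uptoD big_cat/= [X in _ + X]big1_seq ?addr0.
    by rewrite (_ : primes_upto 7 = [:: 2; 3; 5; 7]%N)// !big_cons !big_nil.
  move=> p /andP[_]; rewrite mem_filter mem_iota => /and3P[_ p7 _].
  by rewrite leqNgt p7/= mul0r.
have -> : \sum_(p <- [:: 2; 3; 5; 7]%N) ext p * ln p%:R =
    n%:R * higher_powers R - 5 * \sum_(p <- [:: 2; 3; 5; 7]%N) ln p%:R.
  rewrite /higher_powers !mulr_sumr -sumrB; apply: eq_bigr => p _.
  rewrite /ext sumrB big_const_nat/= -mulr_sumr.
  by move: (\sum_(_ <= _ < _) _) (ln _) => u v /=; ring.
by move: theta; move: (\sum_(p <- primes_upto n) ln p%:R) => t; lra.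
Qed.

(** The constant E: 2 ln 2 comes from the primorial, -1 from Stirling, and the last term is the
    remainder (1 + ln n + 5 S) / n at n = x, with S the sum of ln p over p <= 7. *)
Definition mertens_const (R : realType) (x : nat) : R :=
  2 * ln 2 - 1 - higher_powers R +
  (1 + ln x%:R + 5 * \sum_(p <- [:: 2; 3; 5; 7]%N) ln p%:R) / x%:R.

(** The two bounds on the logarithm of n! are combined and divided by n. *)
Lemma mertens_sum_le (R : realType) (x n : nat) : (7 <= x)%N -> (x <= n)%N ->
  mertens_sum R n <= ln n%:R + mertens_const R x.
Proof.
move=> x7 xn; have n7 := leq_trans x7 xn.
have n0 : (0 < n)%N by exact: leq_trans n7.
have x0 : (0 < x)%N by exact: leq_trans x7.
have h1 := @mertens_sum_fact_le R n n7; have h2 := @ln_fact_le R n n0.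
have lnx0 := ln_natr_ge0 R x.
have S0 : 0 <= \sum_(p <- [:: 2; 3; 5; 7]%N) ln p%:R :> R.
  by apply: sumr_ge0 => p _; exact: ln_natr_ge0.
rewrite /mertens_const; move: S0 h1; set S := \sum_(p <- _) _ => S0 h1.
have xn' : x%:R <= n%:R :> R by rewrite ler_nat.
have x0' : 0 < x%:R :> R by rewrite ltr0n.
have n0' : 0 < n%:R :> R by rewrite ltr0n.
(* This is ln t <= t - 1 at t = n / x; it shows that for n >= x the remainder is largest at n =
   x. *)
have h3 : ln n%:R <= ln x%:R + (n%:R / x%:R - 1) :> R.
  rewrite -lerBlDl -ln_div ?posrE//.
  have -> : n%:R / x%:R = 1 + (n%:R / x%:R - 1) :> R by rewrite addrC subrK.
  by rewrite [leRHS](_ : _ = n%:R / x%:R - 1) ?le_ln1Dx//; [rewrite ltrBrDr addNr divr_gt0|ring].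
have h4 : (1 + ln n%:R + 5 * S) / n%:R <= (1 + ln x%:R + 5 * S) / x%:R.
  rewrite ler_pdivrMr// mulrAC ler_pdivlMr//.
  apply: (@le_trans _ _ ((ln x%:R + n%:R / x%:R + 5 * S) * x%:R)).
    by rewrite ler_pM2r//; lra.
  rewrite [X in X <= _](_ : _ = (ln x%:R + 5 * S) * x%:R + n%:R); last by field; rewrite lt0r_neq0.
  by move: (ln _) lnx0 => l l0; nra.
apply: (@le_trans _ _ (ln n%:R + (2 * ln 2 - 1 - higher_powers R + (1 + ln n%:R + 5 * S) / n%:R))).
  rewrite -(ler_pM2l n0').
  rewrite [leRHS](_ : _ = n%:R * ln n%:R + n%:R * (2 * ln 2) - n%:R - n%:R * higher_powers R
     + 1 + ln n%:R + 5 * S); last by field; rewrite lt0r_neq0.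
  by lra.
by rewrite !lerD2l.
Qed.

Lemma ln_gt0_nat (R : realType) (x : nat) : (1 < x)%N -> 0 < ln x%:R :> R.
Proof. by move=> x1; rewrite ln_gt0// ltr1n. Qed.

Lemma ln_ratio_le (R : realType) (a b : R) : 0 < a -> 0 < b ->
  (b - a) / b <= ln b - ln a.
Proof.
move=> a0 b0; rewrite -[ln b - ln a]opprB -ln_div ?posrE// lerNr.
rewrite [leRHS](_ : _ = a / b - 1); last by field; rewrite lt0r_neq0.
have := @le_ln1Dx R (a / b - 1); rewrite [1 + _]addrC subrK; apply.
by rewrite ltrBrDr addNr divr_gt0.
Qed.

(* Partial summation: the quantity [ln F y + 1 / y + (ln y + E - A y) / ln y
   - ln (ln y)], with [F] the Euler product and [A] the Mertens sum, does not
   increase with [y]. *)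
Lemma euler_prod_mertens (R : realType) (x y : nat) : (7 <= x)%N -> (x <= y)%N ->
  ln (euler_prod R (primes_upto y)) <= ln (ln y%:R) +
   (ln (euler_prod R (primes_upto x)) - ln (ln x%:R) + x%:R^-1 +
     (ln x%:R + mertens_const R x - mertens_sum R x) / ln x%:R).
Proof.
move=> x7; set E := mertens_const R x.
pose I y := ln (euler_prod R (primes_upto y)) - ln (ln y%:R) + y%:R^-1 +
     (ln y%:R + E - mertens_sum R y) / ln y%:R.
suff : forall y, (x <= y)%N -> I y <= I x.
  move=> h xy; rewrite -lerBlDl; apply: le_trans (h _ xy); rewrite /I -addrA lerDl.
  rewrite addr_ge0 ?invr_ge0// divr_ge0 ?ln_natr_ge0// subr_ge0.
  exact: mertens_sum_le.
elim=> [|{}y IH]; first by rewrite leqn0 => /eqP x0; rewrite x0 in x7.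
rewrite leq_eqVlt => /orP[/eqP->//|]; rewrite ltnS => xy.
apply: le_trans (IH xy).
have y7 := leq_trans x7 xy; have y0n : (0 < y)%N by exact: leq_trans y7.
have l0 : 0 < ln y%:R :> R by rewrite ln_gt0_nat// (leq_trans _ y7).
have m0 : 0 < ln y.+1%:R :> R by rewrite ln_gt0_nat// (leq_trans _ y7).
have A0 : 0 <= ln y%:R + E - mertens_sum R y by rewrite subr_ge0 mertens_sum_le.
have lm : ln y%:R <= ln y.+1%:R :> R.
  by rewrite ler_ln ?posrE ?ltr0n ?ler_nat ?y0n.
(* The change of the last term of [I] while the Mertens sum stays fixed, absorbed by the growth of
   ln ln y. *)
have step : (ln y.+1%:R + E - mertens_sum R y) / ln y.+1%:R <=
   (ln y%:R + E - mertens_sum R y) / ln y%:R + (ln (ln y.+1%:R) - ln (ln y%:R)).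
  apply: (@le_trans _ _ ((ln y%:R + E - mertens_sum R y) / ln y.+1%:R +
      (ln y.+1%:R - ln y%:R) / ln y.+1%:R)).
    by rewrite -mulrDl ler_pM2r ?invr_gt0//; lra.
  rewrite lerD ?ln_ratio_le// ler_wpM2l// lef_pV2 ?posrE//.
have y0 : 0 < y%:R :> R by rewrite ltr0n (leq_trans _ y7).
rewrite /I primes_uptoS /mertens_sum primes_uptoS; case: ifP => pp; last first.
  have : y.+1%:R^-1 <= y%:R^-1 :> R by rewrite lef_pV2 ?posrE ?ltr0n ?ler_nat.
  move: step; rewrite /mertens_sum.
  by move: (_ / ln y.+1%:R) (_ / ln y%:R) (ln (euler_prod _ _)) (y.+1%:R^-1)
    (y%:R^-1) (ln (ln y.+1%:R)) (ln (ln y%:R)) => ? ? ? ? ? ? ? h1 h2; lra.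
rewrite -cats1 big_cat big_seq1/= euler_prod_cat.
have F0 : 0 < euler_prod R (primes_upto y).
  by apply: lt_le_trans (euler_prod_ge1 _ _ (all_prime_upto y)).
(* A new prime y + 1 adds at most 1 / y to the logarithm of the product. The Mertens term loses 1 /
   (y + 1) and the term 1 / y loses 1 / y - 1 / (y + 1), which compensates exactly. *)
have e1 : euler_prod R [:: y.+1] = 1 + y%:R^-1.
  by rewrite /euler_prod big_seq1/= -natr1 mulrDl mulfV ?mul1r// lt0r_neq0.
have f0 : 0 < 1 + y%:R^-1 :> R by rewrite addr_gt0 ?invr_gt0.
have e2 : ln (1 + y%:R^-1) <= y%:R^-1 :> R.
  by apply: le_ln1Dx; rewrite (lt_trans _ (_ : 0 < y%:R^-1)) ?invr_gt0// ltrN10.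
rewrite lnM ?posrE// ?e1//.
have -> : ln y.+1%:R + E - (\sum_(p <- primes_upto y) ln p%:R / p%:R + ln y.+1%:R / y.+1%:R) =
   ln y.+1%:R + E - mertens_sum R y - ln y.+1%:R / y.+1%:R by rewrite opprD addrA.
rewrite mulrBl -[ln y.+1%:R / _ / _]mulrAC divff ?lt0r_neq0// mul1r.
move: step e2; rewrite /mertens_sum.
set a := (_ / ln y.+1%:R); set b := (_ / ln y%:R); set c := ln (1 + _).
set u := y.+1%:R^-1; set v := y%:R^-1; set d := ln (euler_prod _ _).
set e := ln (ln y.+1%:R); set f := ln (ln y%:R).
by move: a b c u v d e f => a b c u v d e f h1 h2; lra.
Qed.

(** * Finite verification and conclusion *)

Definition primesN (y : nat) : seq N := map N.of_nat (primes_upto y).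

(** Fixed-point Euler product with scale [c]; the [+ 1] after each division rounds up. *)
Definition euler_ub (c : N) (s : seq N) : N :=
  foldr (fun p acc => acc * p / N.pred p + 1)%num c s.

Lemma euler_prod_le_ub (R : realType) (c : N) (s : seq nat) : all prime s ->
  euler_prod R s * (N.to_nat c)%:R <= (N.to_nat (euler_ub c (map N.of_nat s)))%:R.
Proof.
elim: s => [_|p s IH /= /andP[pp sp]]; first by rewrite /euler_prod big_nil mul1r.
have p1 := prime_gt1 pp; move: (IH sp) => {}IH.
have p1' : 0 < p.-1%:R :> R by rewrite ltr0n; lia.
rewrite /euler_prod big_cons -/(euler_prod R s).
rewrite [leLHS](_ : _ = p%:R * (euler_prod R s * (N.to_nat c)%:R) / p.-1%:R); last by ring.
rewrite ler_pdivrMr//; move: IH; rewrite [map _ _]/= [euler_ub _ _]/=; move: (euler_ub c _) => t IH.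
apply: (@le_trans _ _ (p%:R * (N.to_nat t)%:R)); first by rewrite ler_wpM2l.
rewrite -!natrM ler_nat.
have e1 : N.of_nat p.-1 = N.pred (N.of_nat p) by lia.
have := N.mul_succ_div_gt (t * N.of_nat p) (N.of_nat p.-1).
rewrite -e1; move: (N.div _ _) => q /(_ ltac:(lia)); nia.
Qed.

(** A lower bound for 32 times the binary logarithm of the product, obtained without forming the
    primorial. *)
Definition log2_prod (s : seq N) : N :=
  foldr (fun p acc => log2_lb (2 ^ 20) 5 (p * 2 ^ 20) + acc)%num 0%num s.

Lemma log2_lb_nat (R : realType) (m k : nat) : (0 < k)%N ->
  2 ^+ N.to_nat (log2_lb (2 ^ 20) m (N.of_nat k * 2 ^ 20)) <= k%:R ^+ (2 ^ m) :> R.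
Proof.
move=> k0; apply: (@log2_lb_le _ (2 ^ 20)) => //.
  by have : (1 <= N.of_nat k)%num by [lia]; move: (2 ^ 20)%num => s; nia.
by rewrite (N_mul (N.of_nat k)) natrM Nat2N.id.
Qed.

Lemma log2_prod_le (R : realType) (s : seq nat) : all (leq 1) s ->
  2 ^+ N.to_nat (log2_prod (map N.of_nat s)) <= (\prod_(p <- s) p)%N%:R ^+ 32 :> R.
Proof.
elim: s => [_|p s IH]; first by rewrite big_nil expr1n.
move=> /andP[p0 /IH {}IH]; rewrite big_cons natrM exprMn.
have -> : log2_prod (map N.of_nat (p :: s)) =
  (log2_lb (2 ^ 20) 5 (N.of_nat p * 2 ^ 20) + log2_prod (map N.of_nat s))%num by [].
rewrite N2Nat.inj_add exprD; apply: ler_pM IH; rewrite ?exprn_ge0//.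
exact: (log2_lb_nat R 5 p p0).
Qed.

Lemma ln_ge_log2_lb (R : realType) (m k : nat) : (0 < k)%N ->
  (N.to_nat (log2_lb (2 ^ 20) m (N.of_nat k * 2 ^ 20)))%:R / (2 ^ m)%:R * ln 2
  <= ln k%:R :> R.
Proof.
by move=> k0; apply: ln_ge_log2; rewrite ?expn_gt0 ?ltr0n//; exact: log2_lb_nat.
Qed.

Lemma primesN_filter (y z : nat) : (y <= z)%N ->
  primesN y = [seq p <- primesN z | N.leb p (N.of_nat y)].
Proof.
move=> yz; rewrite /primesN filter_map -(subnKC yz) primes_uptoD filter_cat.
rewrite -[LHS]cats0 map_cat; congr (_ ++ _).
  congr map; apply/esym/all_filterP/allP => p.
  by rewrite mem_primes_upto => /andP[py _] /=; lia.
rewrite (eq_in_filter (a2 := pred0)) ?filter_pred0// => p.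
by rewrite mem_filter mem_iota => /and3P[_ yp _] /=; lia.
Qed.

(* Evaluated once, so that the checks below need not test primality in unary. *)
Definition primes_4400 : seq N := Eval vm_compute in primesN (N.to_nat 4400).

Lemma primes_4400E : primesN (N.to_nat 4400) = primes_4400.
Proof. by vm_compute. Qed.

Definition primes_below (y : N) : seq N := [seq p <- primes_4400 | N.leb p y].

Lemma primes_belowE (y : nat) : N.leb (N.of_nat y) 4400 ->
  primesN y = primes_below (N.of_nat y).
Proof.
move=> y4400; rewrite /primes_below -primes_4400E.
by apply: primesN_filter; lia.
Qed.

(** A certificate for all n in [2^m, 2^m'): the third condition puts 2^m' at or below y + 1 times
    the primorial of y, the fourth puts F(y) below 2.36 ln ln(2^m). *)
Definition checkpoint (m m' : N) (y : nat) : bool :=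
  let l := primes_below (N.of_nat y) in
  [&& N.leb (N.of_nat y) 4400, N.leb (256 * 10000) (256 * m * 6929),
      N.leb (32 * m') (log2_prod (N.of_nat y.+1 :: l)) &
      N.ltb (euler_ub (10 ^ 8) l * (100 * (256 * 10000)))
        (236 * (lnln_lb (256 * m) * 6929) * 10 ^ 8)].

Lemma checkpointP (R : realType) (m m' : N) (y n : nat) : checkpoint m m' y ->
  (2 ^ N.to_nat m <= n < 2 ^ N.to_nat m')%N ->
  euler_prod R (primes n) < 236 / 100 * ln (ln n%:R).
Proof.
move=> /and4P[/primes_belowE yE c1 c2 c3] /andP[mn nm]; rewrite -yE in c2 c3.
have n0 : (0 < n)%N by apply: leq_trans mn; rewrite expn_gt0.
have h1 : (N.to_nat (256 * m))%:R / 256 * ln 2 <= ln n%:R :> R.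
  have -> : (N.to_nat (256 * m))%:R / 256 = (N.to_nat m)%:R :> R.
    rewrite (N_mul 256) natrM -(NRE R 256).
    by have -> : NR R 256 = 256 by [rewrite /NR /=; ring]; field.
  rewrite mulr_natl -lnXn// ler_ln ?posrE ?exprn_gt0 ?ltr0n//.
  by rewrite -natrX ler_nat.
have h2 := lnln_ge _ _ _ c1 h1.
have h3 : euler_prod R (primes n) <= euler_prod R (primes_upto y).
  apply: euler_prod_primorial => //; apply: leq_trans nm _.
  have sy : all (leq 1) (y.+1 :: primes_upto y).
    by apply/allP => p; rewrite inE => /orP[/eqP->//|/(allP (all_prime_upto y))/prime_gt0].
  have := log2_prod_le R _ sy; rewrite [in (_ :: _)]/= -/(primesN y) big_cons => h.
  rewrite -(ler_nat R) natrX -(@ler_pXn2r _ 32)// ?nnegrE ?exprn_ge0//.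
  apply: le_trans h; rewrite -exprM ler_weXn2l ?ler1n//.
  by move/N_leq: c2; rewrite (N_mul 32) mulnC.
apply: le_lt_trans h3 _; apply: lt_le_trans (_ : 236 / 100 *
   ((N.to_nat (lnln_lb (256 * m)))%:R / 256 * ln2_low R) <= _); last first.
  by apply: ler_wpM2l h2; lra.
have := euler_prod_le_ub R (10 ^ 8) _ (all_prime_upto y).
rewrite -/(primesN y); move: c3.
move: (10 ^ 8)%num (ltac:(done) : is_true (N.ltb 0 (10 ^ 8))) => c c0 c3 h4.
have C0 : 0 < (N.to_nat c)%:R :> R by rewrite ltr0n; lia.
rewrite -(ltr_pM2r C0); apply: le_lt_trans h4 _; move: c3.
move: (euler_ub _ _) (lnln_lb _) => q t c3.
have : (N.to_nat q * N.to_nat (100 * (256 * 10000)) <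
   N.to_nat 236 * (N.to_nat t * N.to_nat 6929) * N.to_nat c)%N.
  by rewrite -!N_mul; lia.
rewrite -(ltr_nat R) !natrM (N_mul 100) (N_mul 256) !natrM.
rewrite -(NRE R 100) -(NRE R 256) -(NRE R 10000) -(NRE R 236) -(NRE R 6929).
have -> : NR R 100 = 100 by rewrite /NR /=; ring.
have -> : NR R 256 = 256 by rewrite /NR /=; ring.
have -> : NR R 10000 = 10000 by rewrite /NR /=; ring.
have -> : NR R 6929 = 6929 by rewrite /NR /=; ring.
have -> : NR R 236 = 236 by rewrite /NR /=; ring.
move: (N.to_nat q)%:R (N.to_nat t)%:R (N.to_nat c)%:R => {c0 C0 c3}a b d h.
have -> : 236 / 100 * (b / 256 * ln2_low R) * d =
    236 * (b * 6929) * d / (100 * (256 * 10000)).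
  by rewrite /ln2_low; field.
have K0 : 0 < 100 * (256 * 10000) :> R.
  by apply: mulr_gt0; [|apply: mulr_gt0]; exact: ltr0Sn.
by rewrite (ltr_pdivlMr _ _ K0); exact: h.
Qed.

(** On [a, b) the value ln ln(2n) is replaced by a lower bound for it at the left end a. *)
Definition small_check (a b : nat) : bool :=
  let j := log2_lb (2 ^ 20) 8 (N.of_nat (a.*2) * 2 ^ 20) in
  N.leb (256 * 10000) (j * 6929) &&
  all (fun n => odd n ==> N.ltb (N.of_nat (sumn (divisors n)) * (100 * (256 * 10000)))
        (118 * (lnln_lb j * 6929) * N.of_nat n)) (iota a (b - a)).

Lemma small_checkP (R : realType) (a b n : nat) : (0 < a)%N -> small_check a b ->
  (a <= n < b)%N -> odd n ->
  (sigma n)%:R < 118 / 100 * n%:R * ln (ln (n.*2)%:R) :> R.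
Proof.
move=> a0; have := @ln_ge_log2_lb R 8 a.*2; rewrite /small_check.
move: (log2_lb _ _ _) => j hj /andP[c1 /allP c2] /andP[an nb] on.
have /c2 : n \in iota a (b - a) by rewrite mem_iota; lia.
rewrite on implyTb => {}c2.
have h1 : (N.to_nat j)%:R / 256 * ln 2 <= ln (n.*2)%:R :> R.
  apply: (@le_trans _ _ (ln a.*2%:R)); first by apply: hj; lia.
  by rewrite ler_ln ?posrE ?ltr0n ?ler_nat; lia.
have h2 := lnln_ge _ _ _ c1 h1.
apply: lt_le_trans (_ : 118 / 100 * n%:R *
   ((N.to_nat (lnln_lb j))%:R / 256 * ln2_low R) <= _); last first.
  by apply: ler_wpM2l h2; apply: mulr_ge0 => //; lra.
move: c2; rewrite sumnE; move: (lnln_lb _) => t {h1 h2 c1} c2.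
have : (N.to_nat (N.of_nat (sigma n)) * N.to_nat (100 * (256 * 10000)) <
   N.to_nat 118 * (N.to_nat t * N.to_nat 6929) * N.to_nat (N.of_nat n))%N.
  by rewrite -!N_mul /sigma; lia.
rewrite !Nat2N.id -(ltr_nat R) !natrM (N_mul 100) (N_mul 256) !natrM.
rewrite -(NRE R 100) -(NRE R 256) -(NRE R 10000) -(NRE R 118) -(NRE R 6929).
have -> : NR R 100 = 100 by rewrite /NR /=; ring.
have -> : NR R 256 = 256 by rewrite /NR /=; ring.
have -> : NR R 10000 = 10000 by rewrite /NR /=; ring.
have -> : NR R 6929 = 6929 by rewrite /NR /=; ring.
have -> : NR R 118 = 118 by rewrite /NR /=; ring.
move: (sigma n)%:R (N.to_nat t)%:R n%:R => s {c2}t x h.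
have -> : 118 / 100 * x * (t / 256 * ln2_low R) =
    118 * (t * 6929) * x / (100 * (256 * 10000)).
  by rewrite /ln2_low; field.
have K0 : 0 < 100 * (256 * 10000) :> R.
  by apply: mulr_gt0; [|apply: mulr_gt0]; exact: ltr0Sn.
by rewrite (ltr_pdivlMr _ _ K0); exact: h.
Qed.

(** * Numerical values for the starting point 4096 *)

Lemma ln_small_ge (R : realType) (p j k : nat) : (0 < p)%N -> (0 < k)%N ->
  (2 ^ j <= p ^ k)%N -> j%:R / k%:R * ln 2 <= ln p%:R :> R.
Proof.
by move=> p0 k0 h; apply: ln_ge_log2; rewrite ?ltr0n// -!natrX ler_nat.
Qed.

Lemma higher_powers_ge (R : realType) : 923 / 1000 * ln 2 <= higher_powers R.
Proof.
(* As 2^11 < 3^7, 2^9 < 5^4 and 2^11 < 7^4, all logarithms become multiples of ln 2 and the claim is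
   linear. *)
have h3 := @ln_small_ge R 3 11 7 isT isT isT.
have h5 := @ln_small_ge R 5 9 4 isT isT isT.
have h7 := @ln_small_ge R 7 11 4 isT isT isT.
have l2 : 0 <= ln 2 :> R by exact: ln_natr_ge0.
have geom p : \sum_(2 <= k < 7) (p ^ k)%:R^-1 =
    p%:R^-1 ^+ 2 + p%:R^-1 ^+ 3 + p%:R^-1 ^+ 4 + p%:R^-1 ^+ 5 + p%:R^-1 ^+ 6 :> R.
  rewrite /index_iota/= !big_cons big_nil !natrX !exprVn addr0 !addrA.
  by [].
rewrite /higher_powers; under eq_bigr do rewrite geom.
rewrite !big_cons big_nil addr0.
move: (ln 2) (ln 3) (ln 5) (ln 7) l2 h3 h5 h7 => a b c d l2 h3 h5 h7; lra.
Qed.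

Lemma ln_small_le (R : realType) (p j k : nat) : (0 < p)%N -> (0 < k)%N ->
  (p ^ k <= 2 ^ j)%N -> ln p%:R <= j%:R / k%:R * ln 2 :> R.
Proof.
move=> p0 k0 h; rewrite mulrAC ler_pdivlMr ?ltr0n// mulr_natl mulr_natr.
by rewrite -!lnXn ?ltr0n// ler_ln ?posrE ?exprn_gt0 ?ltr0n// -!natrX ler_nat.
Qed.

Lemma ln_2357_le (R : realType) :
  \sum_(p <- [:: 2; 3; 5; 7]%N) ln p%:R <= 8 * ln 2 :> R.
Proof.
have h3 := @ln_small_le R 3 8 5 isT isT isT.
have h5 := @ln_small_le R 5 7 3 isT isT isT.
have h7 := @ln_small_le R 7 3 1 isT isT isT.
have l2 : 0 <= ln 2 :> R by exact: ln_natr_ge0.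
rewrite !big_cons big_nil addr0.
move: (ln 2) (ln 3) (ln 5) (ln 7) l2 h3 h5 h7 => a b c d l2 h3 h5 h7; lra.
Qed.

Definition log_weight (c p : N) : N := (log2_lb (2 ^ 20) 5 (p * 2 ^ 20) * c)%num.

Lemma mertens_sum_ge (R : realType) (y : nat) (a b c : N) : N.ltb 0 c ->
  N.leb (N.of_nat y) 4400 ->
  N.leb (32 * c * a) (b * sum_div (log_weight c) (primes_below (N.of_nat y))) ->
  NR R a * ln 2 <= NR R b * mertens_sum R y.
Proof.
move=> c0 /primes_belowE <- /N_leq; rewrite (N_mul b) (N_mul (32 * c)) (N_mul 32) -(ler_nat R) !natrM => h.
rewrite !NRE.
have C0 : 0 < (N.to_nat c)%:R :> R by rewrite ltr0n; lia.
have l2 : 0 <= ln 2 :> R by exact: ln_natr_ge0.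
have e32 : (N.to_nat 32)%:R = 32 :> R by rewrite -NRE /NR /=; ring.
have hs : (N.to_nat (sum_div (log_weight c) (primesN y)))%:R * ln 2 <=
   (N.to_nat 32)%:R * (N.to_nat c)%:R * mertens_sum R y.
  have := sum_div_le R (log_weight c) (primesN y).
  move=> /(ler_wpM2r l2) /le_trans; apply.
  rewrite /mertens_sum /primesN big_map mulr_suml mulr_sumr big_seq [leRHS]big_seq.
  apply: ler_sum => p; rewrite mem_primes_upto => /andP[_ /prime_gt0 p0].
  rewrite Nat2N.id /log_weight N_mul natrM e32.
  have := @ln_ge_log2_lb R 5 p p0; move: (log2_lb _ _ _) => t ht.
  have p0' : 0 < p%:R :> R by rewrite ltr0n.
  have {}ht : (N.to_nat t)%:R * ln 2 <= 32 * ln p%:R :> R.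
    by move: ht; rewrite (_ : (2 ^ 5)%N = 32%N)// mulrAC ler_pdivrMr ?ltr0n// [leRHS]mulrC.
  rewrite [leLHS](_ : _ = (N.to_nat t)%:R * ln 2 * ((N.to_nat c)%:R / p%:R)); last by field; rewrite lt0r_neq0.
  rewrite [leRHS](_ : _ = 32 * ln p%:R * ((N.to_nat c)%:R / p%:R)); last by field; rewrite lt0r_neq0.
  by rewrite ler_wpM2r// divr_ge0.
have K0 : 0 < (N.to_nat 32)%:R * (N.to_nat c)%:R :> R by rewrite mulr_gt0// e32 ltr0n.
rewrite -(ler_pM2l K0).
apply: (@le_trans _ _ ((N.to_nat b)%:R * ((N.to_nat (sum_div (log_weight c) (primesN y)))%:R * ln 2))).
  by rewrite !mulrA ler_wpM2r.
by rewrite [leRHS]mulrCA ler_wpM2l.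
Qed.

Lemma mertens_sum_4096 (R : realType) : 1007 / 100 * ln 2 <= mertens_sum R 4096.
Proof.
have e : is_true (N.leb (32 * 10 ^ 6 * 1007)
    (100 * sum_div (log_weight (10 ^ 6)) (primes_below (N.of_nat 4096)))).
  by vm_compute.
have := mertens_sum_ge R 4096 1007 100 (10 ^ 6) isT isT e.
have -> : NR R 1007 = 1007 by rewrite /NR /=; ring.
have -> : NR R 100 = 100 by rewrite /NR /=; ring.
by move: (mertens_sum _ _) (ln 2) {e} => a l h; lra.
Qed.

Lemma euler_prod_upto_le (R : realType) (y : nat) (a b c : N) : N.ltb 0 c ->
  N.leb (N.of_nat y) 4400 ->
  N.leb (euler_ub c (primes_below (N.of_nat y)) * b) (a * c) ->
  euler_prod R (primes_upto y) * NR R b <= NR R a.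
Proof.
move=> c0 /primes_belowE <- /N_leq; rewrite (N_mul a) N_mul -(ler_nat R) !natrM => h.
have C0 : 0 < (N.to_nat c)%:R :> R by rewrite ltr0n; lia.
rewrite !NRE -(ler_pM2r C0); apply: le_trans h; rewrite mulrAC ler_wpM2r//.
exact: euler_prod_le_ub (all_prime_upto y).
Qed.

Lemma euler_prod_4096 (R : realType) : euler_prod R (primes_upto 4096) <= 1485 / 100.
Proof.
have e : is_true (N.leb (euler_ub (10 ^ 8) (primes_below (N.of_nat 4096)) * 100)
    (1485 * 10 ^ 8)) by vm_compute.
have := euler_prod_upto_le R 4096 1485 100 (10 ^ 8) isT isT e.
have -> : NR R 1485 = 1485 by rewrite /NR /=; ring.
have -> : NR R 100 = 100 by rewrite /NR /=; ring.
by move: (euler_prod _ _) {e} => a h; lra.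
Qed.

Lemma expR_254_le (R : realType) : expR (254 / 1000) <= 129 / 100 :> R.
Proof.
have h : is_true (N.leb (10 ^ 12 * 100) (129 * sqr_chain (10 ^ 12) 10
    (10 ^ 12 * (2 ^ N.of_nat 10 * 1000 - 254) / (2 ^ N.of_nat 10 * 1000)))).
  by vm_compute.
have := expR_frac_le R 10 (10 ^ 12) 254 1000 129 100 isT isT h.
have -> : NR R 254 = 254 by rewrite /NR /=; ring.
have -> : NR R 1000 = 1000 by rewrite /NR /=; ring.
have -> : NR R 129 = 129 by rewrite /NR /=; ring.
have -> : NR R 100 = 100 by rewrite /NR /=; ring.
by move: (expR _) {h} => e he; lra.
Qed.

Lemma ln_4096 (R : realType) : ln 4096%:R = 12 * ln 2 :> R.
Proof.
have -> : 4096%N = (2 ^ 12)%N by [].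
by rewrite natrX lnXn// mulr_natl.
Qed.

Lemma ln2_ge_69 (R : realType) : 69 / 100 <= ln 2 :> R.
Proof. by apply: le_trans (ln2_ge R); rewrite /ln2_low; lra. Qed.

Lemma ln2_le_7 (R : realType) : ln 2 <= 7 / 10 :> R.
Proof. by apply: le_trans (ln2_le R) _; lra. Qed.

(** The exponent lost in total: by the partial summation from 4096, and by the prime factors above
    y. Since 4096 = 2^12, the estimate is linear in ln 2. *)
Lemma mertens_gap_4096 (R : realType) :
  4096%:R^-1 + (ln 4096%:R + mertens_const R 4096 - mertens_sum R 4096) / ln 4096%:R
   + (1 + 4096%:R^-1) / ln 4096%:R <= 254 / 1000 :> R.
Proof.
have u1 : 4096%:R^-1 <= 1 / 1000 :> R.
  rewrite div1r lef_pV2 ?posrE; [|exact: ltr0Sn..].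
  by rewrite ler_nat.
have e1 : (1 + ln 4096%:R + 5 * \sum_(p <- [:: 2; 3; 5; 7]%N) ln p%:R) / 4096%:R <= 1 / 100 :> R.
  have hS := ln_2357_le R; have hl := ln2_le_7 R.
  rewrite ln_4096 ler_pdivrMr; last exact: ltr0Sn.
  have h4 : 4000 <= 4096%:R :> R by rewrite ler_nat.
  by move: (\sum_(_ <- _) _) (ln 2) (4096%:R) hS hl h4; clear; move=> S l x hS hl h4; lra.
have hA := mertens_sum_4096 R; have hH := higher_powers_ge R; have hl := ln2_ge_69 R.
have l0 : 0 < ln 2 :> R by rewrite ln_gt0_nat.
move: e1; rewrite /mertens_const ln_4096.
move: hA hH u1; set u := 4096%:R^-1; set t := _ / 4096%:R.
set A := mertens_sum _ _; set H := higher_powers _; move: t u A H.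
move: (ln 2) l0 hl; clear; move=> l l0 hl t u A H hA hH hu ht.
have m0 : 0 < 12 * l by lra.
(* Over the denominator 12 ln 2, the -1 in E cancels the 1 of the last fraction, leaving a numerator
   of at most 3.007 ln 2 + 0.011. *)
rewrite -addrA -mulrDl; apply: (@le_trans _ _ (1 / 1000 + 253 / 1000)); last by lra.
by rewrite lerD// ler_pdivrMr//; lra.
Qed.

Lemma euler_prod_upto_gt0 (R : realType) (y : nat) :
  0 < euler_prod R (primes_upto y).
Proof. exact: lt_le_trans ltr01 (euler_prod_ge1 R _ (all_prime_upto y)). Qed.

(** * The range of large n, and the assembly of all ranges *)

Lemma euler_prod_large (R : realType) (x n : nat) (s c : R) : (7 <= x)%N ->
  x%:R^-1 + (ln x%:R + mertens_const R x - mertens_sum R x) / ln x%:R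
   + (1 + x%:R^-1) / ln x%:R <= s ->
  euler_prod R (primes_upto x) * expR s < c * ln x%:R ->
  x%:R <= ln n%:R :> R -> euler_prod R (primes n) < c * ln (ln n%:R).
Proof.
move=> x7 gap num; set L := ln n%:R => xL.
have xn0 : (0 < x)%N by exact: leq_trans x7.
have x0 : 0 < x%:R :> R by rewrite ltr0n.
have L0 : 0 < L by apply: lt_le_trans xL.
have n0 : (0 < n)%N.
  (* The convention ln 0 = 0 excludes n = 0. *)
  by case: n @L xL L0 => // L _; rewrite /L ln0// ltxx.
pose y := Num.truncn L.
have /andP[yL Ly] : y%:R <= L < y.+1%:R by apply: truncn_itv; exact: ltW.
have xy : (x <= y)%N by rewrite -ltnS -(ltr_nat R); apply: le_lt_trans Ly.
have y0 : (0 < y)%N by rewrite (leq_trans _ xy)// (leq_trans _ x7).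
have [m Em mn] := @euler_prod_split R n y n0 y0.
have lx0 : 0 < ln x%:R :> R by rewrite ln_gt0_nat// (leq_trans _ x7).
have y0' : 0 < y%:R :> R by rewrite ltr0n.
have lxy : ln x%:R <= ln y%:R :> R by rewrite ler_ln ?posrE// ler_nat.
have lxy1 : ln x%:R <= ln y.+1%:R :> R.
  by rewrite ler_ln ?posrE ?ltr0n// ler_nat leqW.
have ly0 : 0 < ln y%:R :> R by apply: lt_le_trans lxy.
have F0 := euler_prod_upto_gt0 R.
have c0 : 0 < c.
  by rewrite -(pmulr_lgt0 _ lx0); apply: lt_trans num; rewrite mulr_gt0 ?expR_gt0.
(* From (y + 1)^m <= n and ln n < y + 1 one gets m ln(y + 1) <= y + 1; then x <= y gives the
   bound. *)
have my : m%:R / y%:R <= (1 + x%:R^-1) / ln x%:R :> R.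
  have h : m%:R * ln y.+1%:R <= y.+1%:R :> R.
    apply: le_trans (ltW Ly); rewrite mulr_natl -lnXn ?ltr0n// -natrX.
    by rewrite ler_ln ?posrE ?ltr0n ?expn_gt0// ler_nat.
  rewrite ler_pdivrMr// mulrAC ler_pdivlMr//.
  apply: (@le_trans _ _ (m%:R * ln y.+1%:R)); first by rewrite ler_wpM2l.
  apply: le_trans h _; rewrite -natr1 mulrDl mul1r lerD2l mulrC ler_pdivlMr// mul1r.
  by rewrite ler_nat.
have hE : euler_prod R (primes n) <= euler_prod R (primes_upto y) * expR (m%:R / y%:R).
  apply: le_trans Em _; rewrite ler_wpM2l//; first exact: ltW.
  rewrite expRM_natl lerXn2r ?nnegrE ?expR_ge0 ?divr_ge0//.
  apply: le_trans (expR_ge1Dx _).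
  by rewrite -natr1 mulrDl divff ?lt0r_neq0// mul1r.
have hF : euler_prod R (primes_upto y) * expR (m%:R / y%:R) <=
    ln y%:R * (euler_prod R (primes_upto x) / ln x%:R * expR s).
  rewrite -ler_ln ?posrE ?mulr_gt0 ?invr_gt0 ?expR_gt0//.
  rewrite !lnM ?posrE ?mulr_gt0 ?invr_gt0 ?expR_gt0// lnV ?posrE// !expRK.
  have := @euler_prod_mertens R x y x7 xy.
  move: gap my; clear.
  set e := (1 + _) / _; set d := _ / ln x%:R; set f := m%:R / _.
  set a := ln (euler_prod _ _); set b := ln (ln x%:R); set g := x%:R^-1.
  set i := ln (ln y%:R); set h := ln (euler_prod _ _).
  by move: a b d e f g h i => a b d e f g h i h1 h2 h3; lra.
apply: le_lt_trans hE _; apply: le_lt_trans hF _.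
have hy : ln y%:R <= ln L by rewrite ler_ln ?posrE.
apply: lt_le_trans (_ : c * ln y%:R <= _); last by rewrite ler_wpM2l// ltW.
by rewrite mulrC ltr_pM2r// mulrAC ltr_pdivrMr.
Qed.

(** Numerically, 14.85 * 1.29 < 19.16 while 2.36 * 12 * 0.69 > 19.53. *)
Lemma euler_prod_expR_4096 (R : realType) :
  euler_prod R (primes_upto 4096) * expR (254 / 1000) < 236 / 100 * ln 4096%:R.
Proof.
have f0 := ltW (euler_prod_upto_gt0 R 4096).
have e0 := expR_ge0 (254 / 1000 : R).
have hX := euler_prod_4096 R; have he := expR_254_le R; have hl := ln2_ge_69 R.
rewrite ln_4096.
move: (euler_prod _ _) (expR _) (ln 2) hX he hl e0 f0 => f e l; clear.
move=> hf he hl e0 f0.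
by apply: le_lt_trans (ler_pM f0 e0 hf he) _; lra.
Qed.

Fixpoint checkpoints (m : N) (t : seq (N * nat)) : bool :=
  if t is (m', y) :: t' then checkpoint m m' y && checkpoints m' t' else true.

Lemma checkpointsP (R : realType) (m : N) (t : seq (N * nat)) (n : nat) :
  checkpoints m t ->
  (2 ^ N.to_nat m <= n < 2 ^ N.to_nat (last m (map fst t)))%N ->
  euler_prod R (primes n) < 236 / 100 * ln (ln n%:R).
Proof.
elim: t m => [|[m' y] t IH] m /=.
  by move=> _ /andP[h1 h2]; move: (leq_ltn_trans h1 h2); rewrite ltnn.
move=> /andP[c /IH h] /andP[mn nm].
have [nm'|nm'] := ltnP n (2 ^ N.to_nat m')%N; last by apply: h; rewrite nm'.
by apply: (checkpointP R _ _ _ _ c); rewrite mn.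
Qed.

(** The list stops at 2^5920 because 5920 ln 2 exceeds 4096, so that beyond it ln n has reached the
    starting point of the summation by parts. *)
Lemma checkpoints_12_5920 : checkpoints 12
  [:: (14, 11%N); (18, 13%N); (27, 19%N); (53, 41%N); (140, 103%N); (550, 401%N);
      (3580, 2551%N); (5920, 4400%N)]%num.
Proof. by vm_compute. Qed.

Lemma euler_prod_lt (R : realType) (n : nat) : (2 ^ N.to_nat 12 <= n)%N ->
  euler_prod R (primes n) < 236 / 100 * ln (ln n%:R).
Proof.
move=> n12; have [n5920|n5920] := ltnP n (2 ^ N.to_nat 5920)%N.
  by apply: (checkpointsP R _ _ _ checkpoints_12_5920); rewrite n12.
apply: (euler_prod_large R 4096 n _ _ isT (mertens_gap_4096 R) (euler_prod_expR_4096 R)).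
have h : NR R 5920 * ln 2 <= ln n%:R.
  move: n5920; rewrite NRE; move: (N.to_nat 5920) => k kn.
  have k0 : (0 < 2 ^ k)%N by rewrite expn_gt0.
  rewrite mulr_natl -lnXn// -natrX.
  by rewrite ler_ln ?posrE ?ltr0n ?ler_nat// (leq_trans k0).
apply: le_trans h; have := ln2_ge R.
have -> : NR R 5920 = 5920 by rewrite /NR /=; ring.
by move: (ln 2); rewrite /ln2_low; clear; move=> l hl; lra.
Qed.

Fixpoint small_checks (a : nat) (t : seq nat) : bool :=
  if t is b :: t' then [&& (a < b)%N, small_check a b & small_checks b t'] else true.

Lemma small_checksP (R : realType) (a : nat) (t : seq nat) (n : nat) :
  (0 < a)%N -> small_checks a t -> (a <= n < last a t)%N -> odd n ->
  (sigma n)%:R < 118 / 100 * n%:R * ln (ln (n.*2)%:R) :> R.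
Proof.
move=> + + + on; elim: t a => [|b t IH] a a0 /=.
  by move=> _ /andP[h1 h2]; move: (leq_ltn_trans h1 h2); rewrite ltnn.
move=> /and3P[ab c h] /andP[an nt].
have [nb|bn] := ltnP n b; first by apply: (small_checkP R a b) => //; rewrite an.
by apply: (IH b) => //; [exact: leq_trans ab | rewrite bn].
Qed.

(** At each of 21, 45, 105 and 315 the ratio sigma(n) / n exceeds 1.18 ln ln(2a) for the preceding
    left end a, which forces a new interval. *)
Lemma small_checks_17_2049 : small_checks 17 [:: 21; 45; 105; 315; 2049]%N.
Proof. by vm_compute. Qed.

(** For large n the Euler product bound is applied to 2n: as n is odd, the prime 2 doubles the
    product, which halves 2.36 to 1.18. *)
Lemma sigma_odd_lt (R : realType) (n : nat) : (17 <= n)%N -> odd n ->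
  (sigma n)%:R < 118 / 100 * n%:R * ln (ln (n.*2)%:R) :> R.
Proof.
move=> n17 on; have [h|h] := ltnP n 2049.
  by apply: (small_checksP R 17 _ _ isT small_checks_17_2049 _ on); apply/andP.
have n0 : (0 < n)%N by exact: leq_trans n17.
have : (2 ^ N.to_nat 12 <= n.*2)%N.
  have -> : (2 ^ N.to_nat 12)%N = (2048).*2 by [].
  by rewrite leq_double ltnW.
move=> /(euler_prod_lt R); have := sigma_le_euler_prod R _ n0.
have -> : euler_prod R (primes n.*2) = 2 * euler_prod R (primes n).
  rewrite !euler_prod_totient ?double_gt0// -mul2n totient_coprime ?coprime2n//.
  by rewrite mul1n natrM mulrA.
have n0' : 0 < n%:R :> R by rewrite ltr0n.
move: (euler_prod _ _) (ln _) (sigma n)%:R => e l s h1' h2'.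
apply: le_lt_trans h1' _; rewrite mulrAC mulrC ltr_pM2r//.
by clear -h2'; lra.
Qed.

Theorem corollary7p3 (R : realType) (n : nat) (hn : (17 <= n)%N)
    (hodd : odd n) :
  (sigma n)%:R <
    2 / 3 * expR (euler_gamma R) * n%:R * ln (ln (2 * n%:R)).
Proof.
have := sigma_odd_lt R n hn hodd; rewrite -mul2n natrM.
move/lt_le_trans; apply.
have n0 : 0 < n%:R :> R by rewrite ltr0n (leq_trans _ hn).
have l0 : 0 <= ln (ln (2 * n%:R)) :> R.
  (* The sign is read off from the bound itself, whose left side is nonnegative. *)
  have := le_lt_trans (ler0n R (sigma n)) (sigma_odd_lt R n hn hodd).
  by rewrite -mul2n natrM pmulr_rgt0; [exact: ltW | rewrite mulr_gt0//; lra].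
apply: ler_wpM2r l0 _ _ _; apply: ler_wpM2r (ltW n0) _ _ _.
by have := expR_gamma_ge R; lra.
Qed.
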